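(* Let $K$ be an interface element and let $\Gamma_K=\Gamma\cap K$. Then every $\phi\in\mathcal V^m_\beta(K)$ satisfies: (1) point-wise continuity across the interface, $[[\phi]]_{\Gamma_K}=0$; (2) point-wise flux continuity across the interface, $\big[\big[\beta\frac{\partial\phi}{\partial\mathbf n}\big]\big]_{\Gamma_K}=0$.
   Context: Geometry. $\Omega\subset\mathbb R^2$ is a rectangle divided by a simple connected curve $\Gamma$ into $\Omega^+$ and $\Omega^-$; $\beta$ equals the constant $\beta^\pm>0$ on $\Omega^\pm$. $m\ge1$ is an integer. $\mathbf g:[\xi_s,\xi_e]\to\Gamma$ is a $C^{3}$ parametrization of $\Gamma$ with $\mathbf g'\neq0$ everywhere. Set $\boldsymbol\tau=\mathbf g'/\|\mathbf g'\|$, $\mathbf n=Q\boldsymbol\tau$ with $Q=\begin{bmatrix}0&1\\-1&0\end{bmatrix}$, signed curvature $\kappa=\|\mathbf g'\|^{-3}(\mathbf g')^TQ\,\mathbf g''$, and $P_\Gamma(\eta,\xi)=\mathbf g(\xi)+\eta\,\mathbf n(\xi)$. It is assumed that for some $\epsilon>0$ the map $P_\Gamma:[-\epsilon,\epsilon]\times[\xi_s,\xi_e]\to N_\Gamma(\epsilon)$ is a bijection onto its image with nonsingular Jacobian, that normal lines to $\Gamma$ at distinct points do not intersect inside $N_\Gamma(\epsilon)$, and that every point $A$ of $N_\Gamma(\epsilon)$ has a unique parameter $\xi_A$ with $\|A-\mathbf g(\xi_A)\|=\mathrm{dist}(\Gamma,A)$. $R_\Gamma=P_\Gamma^{-1}$.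 Mesh. $\mathcal T_h$ is a uniform mesh of $\Omega$ by rectangles of diameter $h<\epsilon$. An interface element is $K\in\mathcal T_h$ whose interior meets $\Gamma$. If $\xi_1,\dots,\xi_4$ are the parameters $\xi_A$ of its four vertices, let $a_K=\min_i\xi_i$, $b_K=\max_i\xi_i$, $\hat K_F=[-h,h]\times[a_K,b_K]$ (one has $K\subset K_F:=P_\Gamma(\hat K_F)$), $\hat\Gamma_{K_F}=\{0\}\times[a_K,b_K]$, $\hat K_F^-=\hat K_F\cap\{\eta<0\}$, $\hat K_F^+=\hat K_F\cap\{\eta\ge0\}$. The orientation is such that points of $K$ with $\eta>0$ (resp. $\eta<0$) lie in $\Omega^+$ (resp. $\Omega^-$); $\hat\beta=\beta^\pm$ on $\hat K_F^\pm$. For $v$ on $\hat K_F$, $v^\pm=v|_{\hat K_F^\pm}$ and $[[v]]=v^+|_{\eta=0}-v^-|_{\eta=0}$ on $\hat\Gamma_{K_F}$. For functions on $K$, $[[v]]_{\Gamma_K}$ is the limit from $K\cap\Omega^+$ minus the limit from $K\cap\Omega^-$. Operator. With $\psi=(1+\eta\kappa(\xi))^{-1}$, $$\mathscr L(v)=v_{\eta\eta}+J_0v_{\xi\xi}+J_1v_\eta+J_2v_\xi,\quad J_0=\frac{\psi^2}{\|\mathbf g'\|^2},\quad J_1=\kappa\psi,\quad J_2=-\frac{\psi^2}{\|\mathbf g'\|^2}\Big(\eta\kappa'\psi+\frac{\mathbf g'\cdot\mathbf g''}{\|\mathbf g'\|^2}\Big).$$ Spaces. $Q^m(O)$: polynomials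 in $(\eta,\xi)$ of degree $\le m$ in each variable, on $O$; $\mathcal P^m(\hat\Gamma_{K_F})$: polynomials in $\xi$ of degree $\le m$. $\hat{\mathcal V}^m_{\hat\beta}(\hat K_F)$ is the set of $\hat\phi:\hat K_F\to\mathbb R$ with $\hat\phi|_{\hat K_F^\pm}\in Q^m(\hat K_F^\pm)$ such that for all $v\in\mathcal P^m(\hat\Gamma_{K_F})$ $$\int_{\hat\Gamma_{K_F}}[[\hat\phi]]v=0,\quad\int_{\hat\Gamma_{K_F}}[[\hat\beta\hat\phi_\eta]]v=0,\quad\int_{\hat\Gamma_{K_F}}\Big[\Big[\hat\beta\frac{\partial^j}{\partial\eta^j}\mathscr L(\hat\phi)\Big]\Big]v=0\ (0\le j\le m-2).$$ $\mathcal V^m_\beta(K)=\{\hat\phi\circ(R_\Gamma)|_K:\hat\phi\in\hat{\mathcal V}^m_{\hat\beta}(\hat K_F)\}$. *)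

(* Defs.v *)
(* Stdlib reals with Coquelicot; points of the plane are pairs of reals. *)
From Stdlib Require Import Reals.
From Coquelicot Require Import Coquelicot.
Open Scope R_scope.

Definition point : Type := (R * R)%type.

Definition dot (u v : point) : R := fst u * fst v + snd u * snd v.
Definition norm2 (u : point) : R := sqrt (dot u u).
Definition minus2 (u v : point) : point := (fst u - fst v, snd u - snd v).
Definition shift (A : point) (t : R) (v : point) : point :=
  (fst A + t * fst v, snd A + t * snd v).
Definition Q (v : point) : point := (snd v, - fst v).

(* All orders up to [k] are listed because [Derive_n] is total: the existence
   of the top order alone would not force that of the lower ones. *)
Definition C_k (k : nat) (f : R -> R) : Prop :=
  forall x : R,
    (forall j : nat, (j <= k)%nat -> ex_derive_n f j x) /\
    continuous (Derive_n f k) x.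

(* A C^3 map on the compact interval [xi_s, xi_e] is the restriction of a C^3
   map on R, so [param] is taken to be such an extension.  Only its values and
   derivatives on [xi_s, xi_e] matter, and those derivatives do not depend on
   the extension. *)
Record curve : Type := Curve {
  param :> R -> point;
  xi_s : R;
  xi_e : R;
  xi_se : xi_s < xi_e;
  param_C3_fst : C_k 3 (fun t => fst (param t));
  param_C3_snd : C_k 3 (fun t => snd (param t));
  param_simple : forall s t, xi_s <= s <= xi_e -> xi_s <= t <= xi_e ->
    param s = param t -> s = t;
  param_regular : forall t, xi_s <= t <= xi_e ->
    (Derive (fun u => fst (param u)) t, Derive (fun u => snd (param u)) t)
      <> (0, 0)
}.

Section Frame.
Variable G : curve.

Definition in_param (xi : R) : Prop := xi_s G <= xi <= xi_e G.
Definition on_curve (X : point) : Prop := exists xi, in_param xi /\ G xi = X.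

Definition dparam (k : nat) (xi : R) : point :=
  (Derive_n (fun t => fst (G t)) k xi, Derive_n (fun t => snd (G t)) k xi).

Definition speed (xi : R) : R := norm2 (dparam 1 xi).
Definition tangent (xi : R) : point :=
  (fst (dparam 1 xi) / speed xi, snd (dparam 1 xi) / speed xi).
Definition normal (xi : R) : point := Q (tangent xi).
Definition curvature (xi : R) : R :=
  dot (dparam 1 xi) (Q (dparam 2 xi)) / speed xi ^ 3.

Definition P_G (eta xi : R) : point := shift (G xi) eta (normal xi).

Definition jacobian (eta xi : R) : R :=
  Derive (fun e => fst (P_G e xi)) eta * Derive (fun x => snd (P_G eta x)) xi
  - Derive (fun x => fst (P_G eta x)) xi * Derive (fun e => snd (P_G e xi)) eta.

Definition in_tube (eps : R) (A : point) : Prop :=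
  exists eta xi, - eps <= eta <= eps /\ in_param xi /\ A = P_G eta xi.

Definition dist_curve (A : point) : R :=
  real (Glb_Rbar (fun d => exists xi, in_param xi /\ d = norm2 (minus2 A (G xi)))).

Definition is_foot (A : point) (xi : R) : Prop :=
  in_param xi /\ norm2 (minus2 A (G xi)) = dist_curve A.

Record tubular (eps : R) : Prop := Tubular {
  tube_pos : 0 < eps;
  tube_inj : forall eta xi eta' xi',
    - eps <= eta <= eps -> in_param xi ->
    - eps <= eta' <= eps -> in_param xi' ->
    P_G eta xi = P_G eta' xi' -> eta = eta' /\ xi = xi';
  tube_jac : forall eta xi, - eps <= eta <= eps -> in_param xi ->
    jacobian eta xi <> 0;
  (* [P_G . xi], with [eta] ranging over R, is the full normal line at [xi]. *)
  tube_normals : forall xi xi' t t', in_param xi -> in_param xi' -> xi <> xi' ->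
    P_G t xi = P_G t' xi' -> ~ in_tube eps (P_G t xi);
  tube_foot : forall A, in_tube eps A -> exists! xi, is_foot A xi
}.

Definition is_tube_inverse (eps : R) (RG : point -> R * R) : Prop :=
  forall eta xi, - eps <= eta <= eps -> in_param xi ->
    RG (P_G eta xi) = (eta, xi).

Definition psi (eta xi : R) : R := / (1 + eta * curvature xi).
Definition J0 (eta xi : R) : R := psi eta xi ^ 2 / speed xi ^ 2.
Definition J1 (eta xi : R) : R := curvature xi * psi eta xi.
Definition J2 (eta xi : R) : R :=
  - (psi eta xi ^ 2 / speed xi ^ 2) *
    (eta * Derive curvature xi * psi eta xi
     + dot (dparam 1 xi) (dparam 2 xi) / speed xi ^ 2).

Definition d_eta (k : nat) (v : R -> R -> R) (eta xi : R) : R :=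
  Derive_n (fun e => v e xi) k eta.
Definition d_xi (k : nat) (v : R -> R -> R) (eta xi : R) : R :=
  Derive_n (fun x => v eta x) k xi.

Definition L_op (v : R -> R -> R) (eta xi : R) : R :=
  d_eta 2 v eta xi + J0 eta xi * d_xi 2 v eta xi
  + J1 eta xi * d_eta 1 v eta xi + J2 eta xi * d_xi 1 v eta xi.

Definition is_Qm (m : nat) (p : R -> R -> R) : Prop :=
  exists c : nat -> nat -> R, forall eta xi,
    p eta xi = sum_n (fun i => sum_n (fun j => c i j * eta ^ i * xi ^ j) m) m.

Definition is_Pm (m : nat) (p : R -> R) : Prop :=
  exists c : nat -> R, forall xi, p xi = sum_n (fun j => c j * xi ^ j) m.

(* [[v]] on {eta = 0}, for v equal to [vp] where eta >= 0 and [vm] where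
   eta < 0. *)
Definition jump0 (vp vm : R -> R -> R) (xi : R) : R := vp 0 xi - vm 0 xi.

(* [pp] and [pm] are the polynomials extending the two restrictions of
   [phih]; derivatives at the boundary of the fictitious element and traces on
   {eta = 0} are those of these extensions.  Values of [phih] outside the
   fictitious element [-h, h] x [a, b] are irrelevant. *)
Definition V_hat (m : nat) (bp bm h a b : R) (phih : R -> R -> R) : Prop :=
  exists pp pm : R -> R -> R,
    is_Qm m pp /\ is_Qm m pm /\
    (forall eta xi, - h <= eta <= h -> a <= xi <= b ->
       (0 <= eta -> phih eta xi = pp eta xi) /\
       (eta < 0 -> phih eta xi = pm eta xi)) /\
    forall v : R -> R, is_Pm m v ->
      RInt (fun xi => jump0 pp pm xi * v xi) a b = 0 /\
      RInt (fun xi =>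
        jump0 (fun e x => bp * d_eta 1 pp e x)
              (fun e x => bm * d_eta 1 pm e x) xi * v xi) a b = 0 /\
      (forall j : nat, (j + 2 <= m)%nat ->
        RInt (fun xi =>
          jump0 (fun e x => bp * d_eta j (L_op pp) e x)
                (fun e x => bm * d_eta j (L_op pm) e x) xi * v xi) a b = 0).

(* Functions on [K] are represented by functions on the plane of which only
   the values on [K] are constrained. *)
Definition V_K (m : nat) (bp bm h a b : R) (RG : point -> R * R)
    (K : point -> Prop) (phi : point -> R) : Prop :=
  exists phih : R -> R -> R, V_hat m bp bm h a b phih /\
    forall X, K X -> phi X = phih (fst (RG X)) (snd (RG X)).

End Frame.

Definition box (l r b t : R) (X : point) : Prop :=
  l <= fst X <= r /\ b <= snd X <= t.
Definition open_box (l r b t : R) (X : point) : Prop :=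
  l < fst X < r /\ b < snd X < t.

Record mesh : Type := Mesh {
  x_l : R; x_r : R; y_b : R; y_t : R;
  n_x : nat; n_y : nat;
  x_lr : x_l < x_r;
  y_bt : y_b < y_t;
  n_x_pos : (0 < n_x)%nat;
  n_y_pos : (0 < n_y)%nat
}.

Section Mesh.
Variable M : mesh.

Definition domain : point -> Prop := box (x_l M) (x_r M) (y_b M) (y_t M).

Definition h_x : R := (x_r M - x_l M) / INR (n_x M).
Definition h_y : R := (y_t M - y_b M) / INR (n_y M).
Definition diameter : R := sqrt (h_x ^ 2 + h_y ^ 2).

Definition vertex (i j : nat) : point :=
  (x_l M + INR i * h_x, y_b M + INR j * h_y).

Definition cell (i j : nat) : point -> Prop :=
  box (fst (vertex i j)) (fst (vertex (S i) j))
      (snd (vertex i j)) (snd (vertex i (S j))).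
Definition cell_interior (i j : nat) : point -> Prop :=
  open_box (fst (vertex i j)) (fst (vertex (S i) j))
           (snd (vertex i j)) (snd (vertex i (S j))).

Definition interface_element (G : curve) (i j : nat) : Prop :=
  (i < n_x M)%nat /\ (j < n_y M)%nat /\
  exists X, cell_interior i j X /\ on_curve G X.

(* Both sides are relatively open in the closed rectangle, so that they
   contain their points on its boundary. *)
Record divides (G : curve) (Omp Omm : point -> Prop) : Prop := Divides {
  div_cover : forall X, (domain X /\ ~ on_curve G X) <-> (Omp X \/ Omm X);
  div_disjoint : forall X, ~ (Omp X /\ Omm X);
  div_open_p : forall X, Omp X ->
    @locally (prod_UniformSpace R_UniformSpace R_UniformSpace) X
      (fun Y => domain Y -> Omp Y);
  div_open_m : forall X, Omm X ->
    @locally (prod_UniformSpace R_UniformSpace R_UniformSpace) X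
      (fun Y => domain Y -> Omm Y)
}.

End Mesh.

Definition lim_within (S : point -> Prop) (v : point -> R) (X : point) (l : R)
  : Prop :=
  filterlim v
    (within S (@locally (prod_UniformSpace R_UniformSpace R_UniformSpace) X))
    (locally l).

(* Both one-sided limits exist and differ by [d].  When [X] is not adherent to
   one of the sides, the limit from that side is unconstrained. *)
Definition is_jump (Sp Sm : point -> Prop) (v : point -> R) (X : point) (d : R)
  : Prop :=
  exists lp lm, lim_within Sp v X lp /\ lim_within Sm v X lm /\ lp - lm = d.

Definition ex_dir_derive (phi : point -> R) (nu Y : point) : Prop :=
  ex_derive (fun t => phi (shift Y t nu)) 0.
Definition dir_derive (phi : point -> R) (nu Y : point) : R :=
  Derive (fun t => phi (shift Y t nu)) 0.

(* Main.v *)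
(* Both jumps are polynomials of degree at most m in xi whose square has zero
   integral over [a_K, b_K] (take the jump itself as test function), so they
   vanish there.  It remains to transport this to K.

   Since the full normal line at g(y) meets the tube only in its own fibre, the
   sign of (P(eta, x) - g(y)) . g'(y) on the tube is that of x - y.  This yields:
   a vertex in the tube has its own fibre parameter as foot; as K is the convex
   hull of such vertices, the nearest point of Gamma to any X in K is the foot of
   a normal through X (even if it is an endpoint of Gamma), with parameter in
   [a_K, b_K]; and the parameter is continuous on the tube.  By implicit
   differentiation of (X - g(xi)) . g'(xi) = 0, using 1 + eta kappa <> 0, the
   coordinates (eta, xi) are differentiable along lines, with d eta = nu . n(xi)
   and d xi = nu . g'(xi) / (|g'|^2 (1 + eta kappa)).  For nu = n(s) and
   X -> g(s) these tend to 1 and 0, so the normal derivative of phi tends to the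
   eta-derivative of the polynomial at (0, s). *)

Require Import Defs.
From Stdlib Require Import Reals Lra Lia Psatz.
From Coquelicot Require Import Coquelicot.
Open Scope R_scope.

(** * Limits and differentiability on the line *)

Section FilterLimits.
Context {T : Type} {F : (T -> Prop) -> Prop} {FF : Filter F}.

Lemma lim_plus (f g : T -> R) (a b : R) :
  filterlim f F (locally a) -> filterlim g F (locally b) ->
  filterlim (fun x => f x + g x) F (locally (a + b)).
Proof.
  intros Hf Hg.
  exact (filterlim_comp_2 (FF := FF) _ _ _ Hf Hg (filterlim_plus a b)).
Qed.

Lemma lim_mult (f g : T -> R) (a b : R) :
  filterlim f F (locally a) -> filterlim g F (locally b) ->
  filterlim (fun x => f x * g x) F (locally (a * b)).
Proof.
  intros Hf Hg.
  exact (filterlim_comp_2 (FF := FF) _ _ _ Hf Hg (filterlim_mult a b)).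
Qed.

Lemma lim_comp (f g : _ -> R) (a : R) :
  filterlim f F (locally a) -> continuous g a ->
  filterlim (fun x : T => g (f x)) F (locally (g a)).
Proof. intros Hf Hg. exact (filterlim_comp _ _ _ f g _ _ _ Hf Hg). Qed.

Lemma lim_minus (f g : T -> R) (a b : R) :
  filterlim f F (locally a) -> filterlim g F (locally b) ->
  filterlim (fun x => f x - g x) F (locally (a - b)).
Proof.
  intros Hf Hg; apply lim_plus; [exact Hf|].
  exact (filterlim_comp _ _ _ g Ropp _ _ _ Hg (filterlim_opp b)).
Qed.

Lemma lim_inv (f : T -> R) (a : R) :
  a <> 0 -> filterlim f F (locally a) ->
  filterlim (fun x => / f x) F (locally (/ a)).
Proof. intros Ha Hf; apply (lim_comp f Rinv); [exact Hf | exact (continuous_Rinv a Ha)]. Qed.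

Lemma lim_pow (f : T -> R) (a : R) (n : nat) :
  filterlim f F (locally a) ->
  filterlim (fun x => f x ^ n) F (locally (a ^ n)).
Proof.
  intros Hf; induction n as [|n IH]; simpl.
  - apply filterlim_const.
  - apply lim_mult; assumption.
Qed.

Lemma lim_sum_n (f : nat -> T -> R) (a : nat -> R) (n : nat) :
  (forall k, filterlim (f k) F (locally (a k))) ->
  filterlim (fun x => sum_n (fun k => f k x) n) F (locally (sum_n a n)).
Proof.
  intros Hf; induction n as [|n IH].
  - rewrite sum_O; apply (filterlim_ext (f 0%nat)); [|apply Hf].
    intros x; now rewrite sum_O.
  - rewrite sum_Sn.
    apply (filterlim_ext (fun x => sum_n (fun k => f k x) n + f (S n) x)).
    + intros x; now rewrite sum_Sn.
    + apply lim_plus; [exact IH | apply Hf].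
Qed.

Lemma lim_gt0 (f : T -> R) (a : R) :
  filterlim f F (locally a) -> 0 < a -> F (fun x => 0 < f x).
Proof. intros Hf Ha; apply Hf; exact (open_gt 0 a Ha). Qed.

End FilterLimits.

(** The difference quotient of [f] at [a], filled in by [l] at [a] itself; its continuity at [a] is
    exactly differentiability. Continuity elsewhere is recorded so that the intermediate value
    theorem can later be applied to [q] on a whole interval. *)
Lemma caratheodory (f : R -> R) (a l : R) :
  is_derive f a l ->
  exists q : R -> R, q a = l /\ continuous q a /\
    (forall x, x <> a -> continuous f x -> continuous q x) /\
    forall x, f x - f a = (x - a) * q x.
Proof.
  intros Hf.
  exists (fun x => if Req_EM_T x a then l else (f x - f a) / (x - a)).
  repeat split.
  - destruct (Req_EM_T a a); [reflexivity | congruence].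
  - apply filterlim_locally; intros e.
    destruct (Req_EM_T a a) as [_|]; [|congruence].
    destruct Hf as [_ Hf].
    (* Half of [e] turns the non-strict bound of differentiability into the strict one required by
       [ball]. *)
    specialize (Hf a (fun P HP => HP) (pos_div_2 e)).
    revert Hf; apply filter_imp; intros x Hx.
    destruct (Req_EM_T x a) as [E|E]; [apply ball_center|].
    change (Rabs ((f x - f a) / (x - a) - l) < e).
    change (Rabs (f x - f a - (x - a) * l) <= e / 2 * Rabs (x - a)) in Hx.
    replace ((f x - f a) / (x - a) - l)
      with ((f x - f a - (x - a) * l) / (x - a)) by (field; lra).
    assert (Hxa : 0 < Rabs (x - a)) by (apply Rabs_pos_lt; lra).
    rewrite Rabs_div by lra.
    apply Rle_lt_trans with (e / 2); [|destruct e; simpl; lra].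
    apply Rle_div_l; [exact Hxa | exact Hx].
  - intros x Hx Hc.
    apply (continuous_ext_loc _ (fun y => (f y - f a) * / (y - a))).
    + apply (filter_imp (fun y => y <> a)); [|exact (open_neq a x Hx)].
      intros y Hy; destruct (Req_EM_T y a); [contradiction | reflexivity].
    + apply (lim_mult (F := locally x) (fun y => f y - f a) (fun y => / (y - a))).
      * apply lim_minus; [exact Hc | apply filterlim_const].
      * apply lim_inv; [lra|].
        apply lim_minus; [apply filterlim_id | apply filterlim_const].
  - intros x; destruct (Req_EM_T x a) as [->|E]; [ring | field; lra].
Qed.

Lemma is_derive_caratheodory (f q : R -> R) (a : R) :
  continuous q a -> locally a (fun x => f x - f a = (x - a) * q x) ->
  is_derive f a (q a).
Proof.
  intros Hq Hf; split; [apply is_linear_scal_l|].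
  intros y Hy e.
  apply (is_filter_lim_locally_unique (K := R_AbsRing) (V := R_NormedModule)) in Hy.
  subst y.
  pose proof (proj1 (filterlim_locally q (q a)) Hq e) as Hq'.
  generalize (filter_and _ _ Hq' Hf); apply filter_imp; intros x [H1 H2].
  change (Rabs (f x - f a - (x - a) * q a) <= e * Rabs (x - a)).
  change (Rabs (q x - q a) < e) in H1.
  rewrite H2.
  replace ((x - a) * q x - (x - a) * q a) with ((q x - q a) * (x - a)) by ring.
  rewrite Rabs_mult; apply Rmult_le_compat_r; [apply Rabs_pos | lra].
Qed.

(** With [q] the difference quotient of [f] at [x 0], the equation becomes
    [(x t - x 0) * q (x t) = - t * k (x t)]. Near 0 one may divide by [q (x t)], which tends to [l],
    and this upgrades continuity of [x] at 0 to differentiability. *)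
Lemma is_derive_implicit (f k x : R -> R) (l : R) :
  is_derive f (x 0) l -> l <> 0 -> continuous x 0 -> continuous k (x 0) ->
  locally 0 (fun t => f (x t) + t * k (x t) = f (x 0)) ->
  is_derive x 0 (- k (x 0) / l).
Proof.
  intros Hf Hl Hx Hk Heq.
  destruct (caratheodory f (x 0) l Hf) as (q & Hq0 & Hqc & _ & Hq).
  rewrite <- Hq0.
  apply (is_derive_caratheodory x (fun t => - k (x t) / q (x t))).
  - apply (lim_mult (F := locally 0) (fun t => - k (x t)) (fun t => / q (x t))).
    + apply (lim_comp (fun t => k (x t)) Ropp).
      * apply (lim_comp x k); assumption.
      * exact (filterlim_opp (k (x 0))).
    + apply lim_inv; [now rewrite Hq0|].
      apply (lim_comp x q); assumption.
  - assert (Hnz : locally 0 (fun t => q (x t) <> 0)).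
    { apply (lim_comp (F := locally 0) x q (x 0) Hx Hqc (fun y => y <> 0)).
      apply (open_neq 0); now rewrite Hq0. }
    generalize (filter_and _ _ Heq Hnz); apply filter_imp; intros t [H1 H2].
    specialize (Hq (x t)).
    apply Rmult_eq_reg_r with (q (x t)); [|exact H2].
    rewrite <- Hq; field_simplify; [|exact H2]; lra.
Qed.

(** Minimality is assumed only to the right of 0, so that the result applies to a nearest point at
    an endpoint of the curve. *)
Lemma derive_min_nonneg (f : R -> R) (l : R) :
  is_derive f 0 l -> (forall t, 0 < t <= 1 -> f 0 <= f t) -> 0 <= l.
Proof.
  intros Hf Hmin.
  destruct (caratheodory f 0 l Hf) as (q & Hq0 & Hqc & _ & Hq).
  destruct (Rle_lt_dec 0 l) as [H|H]; [exact H|exfalso].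
  assert (Hneg : locally 0 (fun t => q t < 0)).
  { apply (Hqc (fun y => y < 0)); apply (open_lt 0); now rewrite Hq0. }
  destruct Hneg as [d Hd].
  (* A positive point inside both the neighbourhood where [q] is negative and the range of the
     minimality hypothesis. *)
  set (t := Rmin 1 (d / 2)).
  assert (Ht : 0 < t <= 1 /\ t < d).
  { unfold t; destruct d as [d Hd0]; simpl in *.
    unfold Rmin; destruct Rle_dec; lra. }
  assert (Hqt : q t < 0).
  { apply Hd; change (Rabs (t - 0) < d); rewrite Rabs_pos_eq; lra. }
  specialize (Hmin t (proj1 Ht)); specialize (Hq t); nra.
Qed.

Lemma nonvanishing_pos (f : R -> R) (s e a b : R) :
  (forall x, continuous f x) -> (forall x, s <= x <= e -> f x <> 0) ->
  s <= a <= e -> s <= b <= e -> 0 < f a -> 0 < f b.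
Proof.
  intros Hc Hnz Ha Hb Hfa.
  destruct (Rlt_le_dec 0 (f b)) as [H|H]; [exact H|exfalso].
  destruct (IVT_gen f a b 0) as (x & Hx & Hfx).
  - intros x; apply continuity_pt_filterlim; apply Hc.
  - rewrite Rmin_right, Rmax_left by lra; lra.
  - apply (Hnz x); [|exact Hfx].
    revert Hx; unfold Rmin, Rmax; destruct Rle_dec; lra.
Qed.

(** If [p x] were nonzero, the square would be positive on a nondegenerate subinterval around [x],
    and nonnegative on the two remaining pieces. *)
Lemma RInt_sqr_eq_0 (p : R -> R) (a b : R) :
  a < b -> (forall x, continuous p x) -> RInt (fun x => p x * p x) a b = 0 ->
  forall x, a <= x <= b -> p x = 0.
Proof.
  intros Hab Hc Hint x Hx.
  destruct (Req_dec (p x) 0) as [H|H]; [exact H|exfalso].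
  set (f := fun y => p y * p y) in *.
  assert (Hf : forall y, continuous f y).
  { intros y; apply (lim_mult (F := locally y) p p); apply Hc. }
  assert (Hpos : locally x (fun y => 0 < f y)).
  { apply (lim_gt0 (F := locally x) f (f x)); [apply Hf | unfold f; nra]. }
  destruct Hpos as [d Hd].
  (* The interval of half the radius around [x], clipped to [[a, b]]; it stays nondegenerate even
     when [x] is an endpoint, because [a < b]. *)
  set (c := Rmax a (x - d / 2)); set (e := Rmin b (x + d / 2)).
  assert (Hce : a <= c /\ c < e /\ e <= b /\ x - d < c /\ e < x + d).
  { destruct d as [d Hd0]; simpl in c, e |- *; unfold c, e, Rmin, Rmax.
    destruct Rle_dec; destruct Rle_dec; lra. }
  assert (Hex : forall u v, ex_RInt f u v).
  { intros u v; apply (ex_RInt_continuous (V := R_CompleteNormedModule)).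
    intros; apply Hf. }
  assert (H0 : forall u v, u <= v -> 0 <= RInt f u v).
  { intros u v Huv; apply RInt_ge_0; [exact Huv | apply Hex |].
    intros y _; unfold f; nra. }
  assert (H1 : 0 < RInt f c e).
  { apply RInt_gt_0; [lra | | intros; apply Hf].
    intros y Hy; apply Hd; change (Rabs (y - x) < d); apply Rabs_lt_between; lra. }
  pose proof (RInt_Chasles f a c e (Hex _ _) (Hex _ _)) as E1.
  pose proof (RInt_Chasles f a e b (Hex _ _) (Hex _ _)) as E2.
  unfold plus in E1, E2; simpl in E1, E2.
  pose proof (H0 a c); pose proof (H0 e b); lra.
Qed.

(** * Polynomials in two variables *)

(* [sum_n_ext] leaves its premise in the carrier of an abstract monoid, where
   [ring] does not apply. *)
Lemma sum_n_ext_R (f g : nat -> R) (n : nat) :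
  (forall k, f k = g k :> R) -> sum_n f n = sum_n g n.
Proof. exact (sum_n_ext f g n). Qed.

Lemma sum_n_lin (x y : R) (f g : nat -> R) (n : nat) :
  x * sum_n f n + y * sum_n g n = sum_n (fun k => x * f k + y * g k) n.
Proof.
  induction n as [|n IH]; [now rewrite !sum_O|].
  rewrite !sum_Sn, <- IH; unfold plus; simpl; ring.
Qed.

(** The formal partial derivative of the polynomial with coefficients [c]. At [i = 0] the truncated
    exponent [pred 0 = 0] is harmless, since the factor [INR 0] vanishes. *)
Definition dQ_eta (m : nat) (c : nat -> nat -> R) (eta xi : R) : R :=
  sum_n (fun i => sum_n (fun j => c i j * (INR i * eta ^ pred i) * xi ^ j) m) m.
Definition dQ_xi (m : nat) (c : nat -> nat -> R) (eta xi : R) : R :=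
  sum_n (fun i => sum_n (fun j => c i j * eta ^ i * (INR j * xi ^ pred j)) m) m.

(** The chain rule along an arbitrary curve [(u, v)]: a coordinate line gives the partial derivative
    in eta, and the tubular coordinates of a moving point give the directional derivatives of
    [phi]. *)
Lemma is_derive_Qm (m : nat) (c : nat -> nat -> R) (p : R -> R -> R)
  (u v : R -> R) (t du dv : R) :
  (forall eta xi,
    p eta xi = sum_n (fun i => sum_n (fun j => c i j * eta ^ i * xi ^ j) m) m) ->
  is_derive u t du -> is_derive v t dv ->
  is_derive (fun s => p (u s) (v s)) t
    (dQ_eta m c (u t) (v t) * du + dQ_xi m c (u t) (v t) * dv).
Proof.
  intros Hp Hu Hv.
  apply (is_derive_ext
    (fun s => sum_n (fun i => sum_n (fun j => c i j * u s ^ i * v s ^ j) m) m)).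
  { intros s; now rewrite Hp. }
  replace (dQ_eta m c (u t) (v t) * du + dQ_xi m c (u t) (v t) * dv) with
    (sum_n (fun i => sum_n (fun j =>
       c i j * (INR i * du * u t ^ pred i) * v t ^ j
       + c i j * u t ^ i * (INR j * dv * v t ^ pred j)) m) m).
  - apply (is_derive_sum_n (K := R_AbsRing) (V := R_NormedModule)); intros i _.
    apply (is_derive_sum_n (K := R_AbsRing) (V := R_NormedModule)); intros j _.
    apply (is_derive_mult (fun s => c i j * u s ^ i) (fun s => v s ^ j));
      [| apply is_derive_pow; exact Hv | exact Rmult_comm].
    apply (is_derive_scal (fun s => u s ^ i)).
    apply is_derive_pow; exact Hu.
  - unfold dQ_eta, dQ_xi.
    rewrite (Rmult_comm _ du), (Rmult_comm _ dv), sum_n_lin.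
    apply sum_n_ext_R; intros i; rewrite sum_n_lin.
    apply sum_n_ext_R; intros j; ring.
Qed.

Lemma d_eta_Qm (m : nat) (c : nat -> nat -> R) (p : R -> R -> R) (eta xi : R) :
  (forall eta xi,
    p eta xi = sum_n (fun i => sum_n (fun j => c i j * eta ^ i * xi ^ j) m) m) ->
  d_eta 1 p eta xi = dQ_eta m c eta xi.
Proof.
  intros Hp; apply is_derive_unique.
  pose proof (is_derive_Qm m c p (fun e => e) (fun _ => xi) eta 1 0 Hp
    (is_derive_id (K := R_AbsRing) eta) (is_derive_const (K := R_AbsRing) (V := R_NormedModule) xi eta)) as H.
  simpl in H; replace (dQ_eta m c eta xi) with
    (dQ_eta m c eta xi * 1 + dQ_xi m c eta xi * 0) by ring; exact H.
Qed.

Section PolynomialLimits.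
Context {T : Type} {F : (T -> Prop) -> Prop} {FF : Filter F}.

(** The factors are arbitrary sequences, so that the polynomial and both of its partial derivatives
    are covered at once. *)
Lemma lim_sum_sum (c : nat -> nat -> R) (m : nat) (f g : nat -> T -> R) (a b : nat -> R) :
  (forall i, filterlim (f i) F (locally (a i))) ->
  (forall j, filterlim (g j) F (locally (b j))) ->
  filterlim (fun x => sum_n (fun i => sum_n (fun j => c i j * f i x * g j x) m) m) F
    (locally (sum_n (fun i => sum_n (fun j => c i j * a i * b j) m) m)).
Proof.
  intros Hf Hg.
  apply (lim_sum_n (fun i x => sum_n (fun j => c i j * f i x * g j x) m)); intros i.
  apply (lim_sum_n (fun j x => c i j * f i x * g j x)); intros j.
  apply (lim_mult (fun x => c i j * f i x)); [|apply Hg].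
  apply (lim_mult (fun x => c i j)); [apply filterlim_const | apply Hf].
Qed.

Variables (u v : T -> R) (eta xi : R).
Hypotheses (Hu : filterlim u F (locally eta)) (Hv : filterlim v F (locally xi)).

Lemma lim_Qm (m : nat) (c : nat -> nat -> R) (p : R -> R -> R) :
  (forall eta xi,
    p eta xi = sum_n (fun i => sum_n (fun j => c i j * eta ^ i * xi ^ j) m) m) ->
  filterlim (fun x => p (u x) (v x)) F (locally (p eta xi)).
Proof.
  intros Hp.
  apply (filterlim_ext (fun x =>
    sum_n (fun i => sum_n (fun j => c i j * u x ^ i * v x ^ j) m) m)).
  { intros x; now rewrite Hp. }
  rewrite Hp.
  apply (lim_sum_sum c m (fun i x => u x ^ i) (fun j x => v x ^ j)
    (fun i => eta ^ i) (fun j => xi ^ j)); intros; now apply lim_pow.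
Qed.

Lemma lim_dQ_eta (m : nat) (c : nat -> nat -> R) :
  filterlim (fun x => dQ_eta m c (u x) (v x)) F (locally (dQ_eta m c eta xi)).
Proof.
  apply (lim_sum_sum c m (fun i x => INR i * u x ^ pred i) (fun j x => v x ^ j)
    (fun i => INR i * eta ^ pred i) (fun j => xi ^ j)); intros k.
  - apply (lim_mult (fun _ => INR k)); [apply filterlim_const | now apply lim_pow].
  - now apply lim_pow.
Qed.

Lemma lim_dQ_xi (m : nat) (c : nat -> nat -> R) :
  filterlim (fun x => dQ_xi m c (u x) (v x)) F (locally (dQ_xi m c eta xi)).
Proof.
  apply (lim_sum_sum c m (fun i x => u x ^ i) (fun j x => INR j * v x ^ pred j)
    (fun i => eta ^ i) (fun j => INR j * xi ^ pred j)); intros k.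
  - now apply lim_pow.
  - apply (lim_mult (fun _ => INR k)); [apply filterlim_const | now apply lim_pow].
Qed.

End PolynomialLimits.

(** Exchanging the sums collects the coefficient of each [xi ^ j]. The weights [w] are the powers of
    a fixed eta, or their derivatives. *)
Lemma is_Pm_double_sum (m : nat) (c : nat -> nat -> R) (w : nat -> R) :
  is_Pm m (fun xi => sum_n (fun i => sum_n (fun j => c i j * w i * xi ^ j) m) m).
Proof.
  exists (fun j => sum_n (fun i => c i j * w i) m); intros xi.
  rewrite sum_n_switch; apply sum_n_ext_R; intros j.
  exact (sum_n_mult_r (K := R_Ring) (xi ^ j) (fun i => c i j * w i) m).
Qed.

Lemma is_Pm_lin (m : nat) (x y : R) (p q r : R -> R) :
  is_Pm m p -> is_Pm m q -> (forall xi, r xi = x * p xi + y * q xi) -> is_Pm m r.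
Proof.
  intros [c Hc] [d Hd] Hr; exists (fun j => x * c j + y * d j); intros xi.
  rewrite Hr, Hc, Hd, sum_n_lin; apply sum_n_ext_R; intros j; ring.
Qed.

Lemma is_Pm_continuous (m : nat) (p : R -> R) (x : R) : is_Pm m p -> continuous p x.
Proof.
  intros [c Hc].
  apply (continuous_ext (fun xi => sum_n (fun j => c j * xi ^ j) m)).
  { intros y; now rewrite Hc. }
  apply (lim_sum_n (F := locally x) (fun j y => c j * y ^ j)); intros j.
  apply (lim_mult (F := locally x) (fun _ => c j)); [apply filterlim_const |].
  apply (lim_pow (F := locally x) (fun y => y)); apply filterlim_id.
Qed.

Lemma is_Qm_trace (m : nat) (p : R -> R -> R) (eta : R) :
  is_Qm m p -> is_Pm m (p eta).
Proof.
  intros [c Hc].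
  destruct (is_Pm_double_sum m c (fun i => eta ^ i)) as [d Hd].
  exists d; intros xi; now rewrite Hc.
Qed.

Lemma is_Qm_flux_trace (m : nat) (p : R -> R -> R) (eta : R) :
  is_Qm m p -> is_Pm m (d_eta 1 p eta).
Proof.
  intros [c Hc].
  destruct (is_Pm_double_sum m c (fun i => INR i * eta ^ pred i)) as [d Hd].
  exists d; intros xi; rewrite (d_eta_Qm m c p _ _ Hc); exact (Hd xi).
Qed.

(* The jump is an admissible test function for its own weak condition. *)
Lemma weak_jump_eq_0 (m : nat) (q : R -> R) (a b : R) :
  a < b -> is_Pm m q -> RInt (fun xi => q xi * q xi) a b = 0 ->
  forall xi, a <= xi <= b -> q xi = 0.
Proof.
  intros Hab Hq; apply RInt_sqr_eq_0; [exact Hab|].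
  intros x; exact (is_Pm_continuous m q x Hq).
Qed.

(** * The moving frame and the tube *)

Section Geometry.
Variable G : curve.

Lemma C_k_is_derive (k j : nat) (f : R -> R) (x : R) :
  C_k k f -> (j < k)%nat -> is_derive (Derive_n f j) x (Derive_n f (S j) x).
Proof.
  intros Hf Hj; apply Derive_correct.
  exact (proj1 (Hf x) (S j) Hj).
Qed.

Lemma is_derive_dparam_fst (j : nat) (x : R) : (j < 3)%nat ->
  is_derive (fun t => fst (dparam G j t)) x (fst (dparam G (S j) x)).
Proof. exact (C_k_is_derive 3 j _ x (param_C3_fst G)). Qed.

Lemma is_derive_dparam_snd (j : nat) (x : R) : (j < 3)%nat ->
  is_derive (fun t => snd (dparam G j t)) x (snd (dparam G (S j) x)).
Proof. exact (C_k_is_derive 3 j _ x (param_C3_snd G)). Qed.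

Lemma continuous_dparam_fst (j : nat) (x : R) : (j < 3)%nat ->
  continuous (fun t => fst (dparam G j t)) x.
Proof.
  intros Hj; apply (ex_derive_continuous (K := R_AbsRing) (V := R_NormedModule)).
  eexists; exact (is_derive_dparam_fst j x Hj).
Qed.

Lemma continuous_dparam_snd (j : nat) (x : R) : (j < 3)%nat ->
  continuous (fun t => snd (dparam G j t)) x.
Proof.
  intros Hj; apply (ex_derive_continuous (K := R_AbsRing) (V := R_NormedModule)).
  eexists; exact (is_derive_dparam_snd j x Hj).
Qed.

Lemma speed_pos (x : R) : in_param G x -> 0 < speed G x.
Proof.
  intros Hx; apply sqrt_lt_R0; unfold dot.
  destruct (Req_dec (fst (dparam G 1 x)) 0) as [E1|]; [|nra].
  destruct (Req_dec (snd (dparam G 1 x)) 0) as [E2|]; [|nra].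
  exfalso; apply (param_regular G x Hx).
  exact (f_equal2 pair E1 E2).
Qed.

Lemma speed_sqr (x : R) :
  speed G x * speed G x
  = fst (dparam G 1 x) * fst (dparam G 1 x) + snd (dparam G 1 x) * snd (dparam G 1 x).
Proof. apply sqrt_sqrt; unfold dot; nra. Qed.

Lemma continuous_speed (x : R) : continuous (speed G) x.
Proof.
  apply (lim_comp (F := locally x) (fun t => dot (dparam G 1 t) (dparam G 1 t)) sqrt);
    [|apply continuous_sqrt].
  apply lim_plus.
  - apply lim_mult; apply (continuous_dparam_fst 1 x); auto.
  - apply lim_mult; apply (continuous_dparam_snd 1 x); auto.
Qed.

Lemma is_derive_speed (x : R) : in_param G x ->
  is_derive (speed G) x (dot (dparam G 1 x) (dparam G 2 x) / speed G x).
Proof.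
  intros Hx; pose proof (speed_pos x Hx) as HS.
  assert (H : is_derive (fun t => dot (dparam G 1 t) (dparam G 1 t)) x
    (2 * dot (dparam G 1 x) (dparam G 2 x))).
  { unfold dot at 1.
    replace (2 * dot (dparam G 1 x) (dparam G 2 x)) with
      (fst (dparam G 2 x) * fst (dparam G 1 x) + fst (dparam G 1 x) * fst (dparam G 2 x)
       + (snd (dparam G 2 x) * snd (dparam G 1 x) + snd (dparam G 1 x) * snd (dparam G 2 x)))
      by (unfold dot; ring).
    pose proof (is_derive_dparam_fst 1 x ltac:(auto)) as H1.
    pose proof (is_derive_dparam_snd 1 x ltac:(auto)) as H2.
    exact (is_derive_plus _ _ _ _ _ (is_derive_mult _ _ _ _ _ H1 H1 Rmult_comm)
      (is_derive_mult _ _ _ _ _ H2 H2 Rmult_comm)). }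
  replace (dot (dparam G 1 x) (dparam G 2 x) / speed G x) with
    (2 * dot (dparam G 1 x) (dparam G 2 x) / (2 * speed G x)) by (field; lra).
  refine (is_derive_sqrt _ x _ H _).
  unfold dot; rewrite <- speed_sqr; nra.
Qed.

(** The Frenet formula [n' = kappa g'], with [kappa] signed according to the clockwise rotation
    [Q]. *)
Lemma is_derive_normal (x : R) : in_param G x ->
  is_derive (fun t => fst (normal G t)) x (curvature G x * fst (dparam G 1 x)) /\
  is_derive (fun t => snd (normal G t)) x (curvature G x * snd (dparam G 1 x)).
Proof.
  intros Hx; pose proof (speed_pos x Hx) as HS.
  pose proof (speed_sqr x) as HS2.
  pose proof (is_derive_dparam_fst 1 x ltac:(auto)) as H1.
  pose proof (is_derive_dparam_snd 1 x ltac:(auto)) as H2.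
  pose proof (is_derive_speed x Hx) as H3.
  assert (HS0 : speed G x <> 0) by lra.
  split.
  - pose proof (is_derive_div _ _ _ _ _ H2 H3 HS0) as H.
    replace (curvature G x * fst (dparam G 1 x)) with
      ((snd (dparam G 2 x) * speed G x - snd (dparam G 1 x) *
        (dot (dparam G 1 x) (dparam G 2 x) / speed G x)) / speed G x ^ 2); [exact H|].
    unfold curvature, dot, Q; cbn [fst snd].
    (* Over the common denominator [speed ^ 3] the numerator contains [speed * speed], which [HS2]
       expands into the components of [g']. *)
    transitivity ((snd (dparam G 2 x) * (speed G x * speed G x) - snd (dparam G 1 x) *
      (fst (dparam G 1 x) * fst (dparam G 2 x) + snd (dparam G 1 x) * snd (dparam G 2 x)))
      / speed G x ^ 3); [field; lra | rewrite HS2; field; lra].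
  - pose proof (is_derive_opp _ _ _ (is_derive_div _ _ _ _ _ H1 H3 HS0)) as H.
    replace (curvature G x * snd (dparam G 1 x)) with
      (- ((fst (dparam G 2 x) * speed G x - fst (dparam G 1 x) *
        (dot (dparam G 1 x) (dparam G 2 x) / speed G x)) / speed G x ^ 2)); [exact H|].
    unfold curvature, dot, Q; cbn [fst snd].
    transitivity (- (fst (dparam G 2 x) * (speed G x * speed G x) - fst (dparam G 1 x) *
      (fst (dparam G 1 x) * fst (dparam G 2 x) + snd (dparam G 1 x) * snd (dparam G 2 x)))
      / speed G x ^ 3); [field; lra | rewrite HS2; field; lra].
Qed.

Lemma continuous_curvature (x : R) : in_param G x -> continuous (curvature G) x.
Proof.
  intros Hx; pose proof (speed_pos x Hx) as HS.
  apply (lim_mult (F := locally x) (fun t => dot (dparam G 1 t) (Q (dparam G 2 t)))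
    (fun t => / speed G t ^ 3)).
  - apply lim_plus.
    + apply lim_mult; [apply (continuous_dparam_fst 1 x); auto
                      |apply (continuous_dparam_snd 2 x); auto].
    + apply lim_mult; [apply (continuous_dparam_snd 1 x); auto|].
      apply (lim_comp (F := locally x) _ Ropp _ (continuous_dparam_fst 2 x ltac:(auto))).
      exact (filterlim_opp _).
  - apply lim_inv; [apply pow_nonzero; lra|].
    apply lim_pow; apply continuous_speed.
Qed.

Lemma normal_unit (x : R) : in_param G x -> dot (normal G x) (normal G x) = 1.
Proof.
  intros Hx; pose proof (speed_pos x Hx) as HS; pose proof (speed_sqr x) as HS2.
  unfold dot, normal, Q, tangent; cbn [fst snd].
  transitivity ((fst (dparam G 1 x) * fst (dparam G 1 x) + snd (dparam G 1 x) * snd (dparam G 1 x))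
    / (speed G x * speed G x)); [|rewrite <- HS2]; field; lra.
Qed.

Lemma normal_orth (x : R) : dot (normal G x) (dparam G 1 x) = 0.
Proof. unfold dot, normal, Q, tangent; cbn [fst snd]; unfold Rdiv; ring. Qed.

(** By the Frenet formula the columns are [n] and [(1 + eta kappa) g'], and the determinant of [n]
    and [g'] is the speed. *)
Lemma jacobian_eq (eta x : R) : in_param G x ->
  jacobian G eta x = (1 + eta * curvature G x) * speed G x.
Proof.
  intros Hx; pose proof (speed_pos x Hx) as HS; pose proof (speed_sqr x) as HS2.
  destruct (is_derive_normal x Hx) as [N1 N2].
  assert (D1 : is_derive (fun y : R => fst (P_G G eta y)) x
    (fst (dparam G 1 x) + eta * (curvature G x * fst (dparam G 1 x)))).
  { apply (is_derive_plus (K := R_AbsRing) (V := R_NormedModule)).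
    - exact (is_derive_dparam_fst 0 x ltac:(auto)).
    - apply is_derive_scal; exact N1. }
  assert (D2 : is_derive (fun y : R => snd (P_G G eta y)) x
    (snd (dparam G 1 x) + eta * (curvature G x * snd (dparam G 1 x)))).
  { apply (is_derive_plus (K := R_AbsRing) (V := R_NormedModule)).
    - exact (is_derive_dparam_snd 0 x ltac:(auto)).
    - apply is_derive_scal; exact N2. }
  assert (D3 : is_derive (fun e : R => fst (P_G G e x)) eta (fst (normal G x))).
  { unfold P_G, shift; simpl; auto_derive; [trivial|ring]. }
  assert (D4 : is_derive (fun e : R => snd (P_G G e x)) eta (snd (normal G x))).
  { unfold P_G, shift; simpl; auto_derive; [trivial|ring]. }
  unfold jacobian; rewrite (is_derive_unique _ _ _ D1), (is_derive_unique _ _ _ D2),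
    (is_derive_unique _ _ _ D3), (is_derive_unique _ _ _ D4).
  unfold normal, Q, tangent; cbn [fst snd].
  apply Rmult_eq_reg_r with (speed G x); [|lra].
  rewrite (Rmult_assoc _ (speed G x)), HS2; field; lra.
Qed.

(** Minus one half of the derivative in [x] of the squared distance from [X] to [G x]. As a function
    of [X] it is affine, and its zero set is the normal line at [x]. *)
Definition tangential (X : point) (x : R) : R := dot (minus2 X (G x)) (dparam G 1 x).

Lemma tangential_P (eta x : R) : tangential (P_G G eta x) x = 0.
Proof.
  unfold tangential, P_G, shift, minus2, dot; cbn [fst snd].
  pose proof (normal_orth x) as H; unfold dot in H.
  transitivity (eta * (fst (normal G x) * fst (dparam G 1 x) +
    snd (normal G x) * snd (dparam G 1 x))); [ring | rewrite H; ring].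
Qed.

(** A vector orthogonal to [g'] equals its projection on the unit normal. *)
Lemma P_of_tangential (X : point) (x : R) :
  in_param G x -> tangential X x = 0 ->
  X = P_G G (dot (minus2 X (G x)) (normal G x)) x.
Proof.
  intros Hx H; pose proof (speed_pos x Hx) as HS; pose proof (speed_sqr x) as HS2.
  destruct X as [X1 X2]; unfold tangential, dot, minus2 in H; simpl in H.
  unfold P_G, shift, dot, minus2, normal, Q, tangent; cbn [fst snd].
  set (p := fst (dparam G 1 x)) in *; set (q := snd (dparam G 1 x)) in *.
  set (S := speed G x) in *; set (u := X1 - fst (G x)) in *; set (v := X2 - snd (G x)) in *.
  assert (E1 : u * p + v * q = 0) by exact H.
  f_equal.
  - replace X1 with (fst (G x) + u) by (unfold u; ring); f_equal.
    (* Since [S * S = p * p + q * q], the vector scaled by it splits into a tangential part, which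
       vanishes by [E1], and a normal part. *)
    apply Rmult_eq_reg_r with (S * S); [|nra].
    transitivity (q * (u * q - v * p)); [|field; lra].
    rewrite HS2; transitivity (p * (u * p + v * q) + q * (u * q - v * p)); [ring|].
    rewrite E1; ring.
  - replace X2 with (snd (G x) + v) by (unfold v; ring); f_equal.
    apply Rmult_eq_reg_r with (S * S); [|nra].
    transitivity (- p * (u * q - v * p)); [|field; lra].
    rewrite HS2; transitivity (q * (u * p + v * q) - p * (u * q - v * p)); [ring|].
    rewrite E1; ring.
Qed.

Lemma eta_of_P (eta x : R) : in_param G x ->
  dot (minus2 (P_G G eta x) (G x)) (normal G x) = eta.
Proof.
  intros Hx; pose proof (normal_unit x Hx) as H; unfold dot in H.
  unfold P_G, shift, minus2, dot; cbn [fst snd].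
  transitivity (eta * (fst (normal G x) * fst (normal G x) +
    snd (normal G x) * snd (normal G x))); [ring | rewrite H; ring].
Qed.

Lemma norm2_P (eta x : R) : in_param G x ->
  norm2 (minus2 (P_G G eta x) (G x)) = Rabs eta.
Proof.
  intros Hx; pose proof (normal_unit x Hx) as H; unfold dot in H.
  unfold norm2, P_G, shift, minus2, dot; cbn [fst snd].
  rewrite <- sqrt_Rsqr_abs; f_equal; unfold Rsqr.
  transitivity (eta * eta * (fst (normal G x) * fst (normal G x) +
    snd (normal G x) * snd (normal G x))); [ring | rewrite H; ring].
Qed.

Lemma is_derive_tangential_param (X : point) (x : R) :
  is_derive (tangential X) x
    (dot (minus2 X (G x)) (dparam G 2 x) - speed G x * speed G x).
Proof.
  pose proof (is_derive_dparam_fst 0 x ltac:(auto)) as F0.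
  pose proof (is_derive_dparam_snd 0 x ltac:(auto)) as S0.
  pose proof (is_derive_dparam_fst 1 x ltac:(auto)) as F1.
  pose proof (is_derive_dparam_snd 1 x ltac:(auto)) as S1.
  pose proof (is_derive_minus _ _ _ _ _ (is_derive_const (fst X) x) F0) as F.
  pose proof (is_derive_minus _ _ _ _ _ (is_derive_const (snd X) x) S0) as S.
  pose proof (is_derive_plus _ _ _ _ _ (is_derive_mult _ _ _ _ _ F F1 Rmult_comm)
      (is_derive_mult _ _ _ _ _ S S1 Rmult_comm)) as H.
  rewrite speed_sqr.
  replace (_ - _) with
    ((0 - fst (dparam G 1 x)) * fst (dparam G 1 x)
     + (fst X - fst (G x)) * fst (dparam G 2 x)
     + ((0 - snd (dparam G 1 x)) * snd (dparam G 1 x)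
        + (snd X - snd (G x)) * snd (dparam G 2 x)));
    [exact H | unfold dot, minus2; cbn [fst snd]; ring].
Qed.

(** Here [X - g = eta n], and [n . g'' = - |g'|^2 kappa]. *)
Lemma is_derive_tangential_P (eta x : R) : in_param G x ->
  is_derive (tangential (P_G G eta x)) x
    (- (speed G x * speed G x) * (1 + eta * curvature G x)).
Proof.
  intros Hx; pose proof (speed_pos x Hx) as HS.
  replace (- (speed G x * speed G x) * (1 + eta * curvature G x)) with
    (dot (minus2 (P_G G eta x) (G x)) (dparam G 2 x) - speed G x * speed G x);
    [apply is_derive_tangential_param|].
  unfold P_G, shift, minus2, dot, curvature, normal, tangent, Q, dot; cbn [fst snd].
  field; lra.
Qed.

Variable eps : R.
Hypothesis Htube : tubular G eps.

Lemma tube_curvature (eta x : R) : - eps <= eta <= eps -> in_param G x ->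
  1 + eta * curvature G x <> 0.
Proof.
  intros He Hx H; apply (tube_jac G eps Htube eta x He Hx).
  rewrite jacobian_eq, H by exact Hx; ring.
Qed.

(** A zero would put a tube point of the fibre at [x] on the full normal line at [y], which
    [tube_normals] forbids. *)
Lemma tangential_P_neq_0 (eta x y : R) : - eps <= eta <= eps ->
  in_param G x -> in_param G y -> x <> y -> tangential (P_G G eta x) y <> 0.
Proof.
  intros He Hx Hy Hxy H.
  pose proof (P_of_tangential _ y Hy H) as E; symmetry in E.
  apply (tube_normals G eps Htube y x _ eta Hy Hx (not_eq_sym Hxy) E).
  rewrite E; now exists eta, x.
Qed.

(* The normal line at [y] separates the two parts [x < y] and [y < x] of the
   tube: [(P(eta, x) - g(y)) . g'(y)] has no zero there, is affine in [eta],
   and at [eta = 0] is [(x - y) q(x)] with [q] continuous and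
   [q(y) = |g'(y)|^2]. *)
Lemma tangential_sign (eta x y : R) : - eps <= eta <= eps ->
  in_param G x -> in_param G y -> x <> y ->
  0 < (x - y) * tangential (P_G G eta x) y.
Proof.
  intros He Hx Hy Hxy.
  pose proof (speed_pos y Hy) as HS; pose proof (tube_pos G eps Htube) as Heps.
  set (u := fun z => tangential (P_G G 0 z) y).
  assert (Hu0 : forall z, in_param G z -> z <> y -> u z <> 0).
  { intros z Hz Hzy; apply tangential_P_neq_0; trivial; lra. }
  assert (Hu : forall z, u z = tangential (G z) y).
  { intros z; unfold u, P_G, shift; unfold tangential, minus2; cbn [fst snd].
    now rewrite !Rmult_0_l, !Rplus_0_r. }
  assert (Dz : forall z, is_derive u z
    (dot (dparam G 1 z) (dparam G 1 y))).
  { intros z.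
    apply (is_derive_ext (fun z => (fst (G z) - fst (G y)) * fst (dparam G 1 y)
      + (snd (G z) - snd (G y)) * snd (dparam G 1 y))).
    { intros t; rewrite Hu; reflexivity. }
    pose proof (is_derive_dparam_fst 0 z ltac:(auto)) as F0.
    pose proof (is_derive_dparam_snd 0 z ltac:(auto)) as S0.
    pose proof (is_derive_minus _ _ _ _ _ F0 (is_derive_const (fst (G y)) z)) as F.
    pose proof (is_derive_minus _ _ _ _ _ S0 (is_derive_const (snd (G y)) z)) as S.
    pose proof (is_derive_plus _ _ _ _ _
      (is_derive_mult _ _ _ _ _ F (is_derive_const (fst (dparam G 1 y)) z) Rmult_comm)
      (is_derive_mult _ _ _ _ _ S (is_derive_const (snd (dparam G 1 y)) z) Rmult_comm)) as H.
    replace (dot (dparam G 1 z) (dparam G 1 y)) with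
      ((fst (dparam G 1 z) - 0) * fst (dparam G 1 y) + (fst (G z) - fst (G y)) * 0
       + ((snd (dparam G 1 z) - 0) * snd (dparam G 1 y) + (snd (G z) - snd (G y)) * 0));
      [exact H | unfold dot; ring]. }
  assert (Cz : forall z, continuous u z).
  { intros z; apply (ex_derive_continuous (K := R_AbsRing) (V := R_NormedModule)).
    eexists; apply Dz. }
  assert (Huy : u y = 0) by apply tangential_P.
  destruct (caratheodory u y _ (Dz y)) as (q & Hqy & Hqc & Hqc' & Hq).
  assert (Hqx : 0 < q x).
  { apply (nonvanishing_pos q (xi_s G) (xi_e G) y x).
    - intros z; destruct (Req_dec z y) as [->|Hzy]; [exact Hqc | apply Hqc'; auto].
    - intros z Hz Hqz; destruct (Req_dec z y) as [->|Hzy].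
      + rewrite Hqy in Hqz; unfold dot in Hqz; rewrite <- speed_sqr in Hqz; nra.
      + apply (Hu0 z Hz Hzy); specialize (Hq z); rewrite Huy, Hqz in Hq; lra.
    - exact Hy.
    - exact Hx.
    - rewrite Hqy; unfold dot; rewrite <- speed_sqr; nra. }
  set (k := dot (normal G x) (dparam G 1 y)).
  assert (Haff : forall e, tangential (P_G G e x) y = u x + e * k).
  { intros e; rewrite Hu; unfold k, tangential, dot, minus2, P_G, shift.
    cbn [fst snd]; ring. }
  assert (Hx0 : 0 < (x - y) * u x).
  { specialize (Hq x); rewrite Huy, Rminus_0_r in Hq; rewrite Hq.
    replace (_ * _) with ((x - y) * (x - y) * q x) by ring.
    apply Rmult_lt_0_compat; [nra | exact Hqx]. }
  (* The path along the fibre from [G x] at [t = 0] to [P_G G eta x] at [t = 1] remains in the tube,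
     so the sign found on the curve persists. *)
  set (w := fun t => (x - y) * tangential (P_G G (t * eta) x) y).
  assert (Hw : 0 < w 1).
  { apply (nonvanishing_pos w 0 1 0 1); try lra.
    - intros t; apply (continuous_ext (fun t => (x - y) * (u x + t * eta * k))).
      { intros r; unfold w; now rewrite Haff. }
      apply (lim_mult (F := locally t)); [apply filterlim_const|].
      apply (lim_plus (F := locally t)); [apply filterlim_const|].
      apply (lim_mult (F := locally t)); [|apply filterlim_const].
      apply (lim_mult (F := locally t)); [apply filterlim_id | apply filterlim_const].
    - intros t Ht; apply Rmult_integral_contrapositive; split; [lra|].
      apply tangential_P_neq_0; trivial; nra.
    - unfold w; rewrite Rmult_0_l; exact Hx0. }
  unfold w in Hw; now rewrite Rmult_1_l in Hw.
Qed.

Lemma in_tube_coordinates (X : point) (RG : point -> R * R) :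
  is_tube_inverse G eps RG -> in_tube G eps X ->
  - eps <= fst (RG X) <= eps /\ in_param G (snd (RG X)) /\
  P_G G (fst (RG X)) (snd (RG X)) = X.
Proof.
  intros HRG (eta & x & He & Hx & ->).
  rewrite (HRG eta x He Hx); auto.
Qed.

End Geometry.

(** * Tubular coordinates *)

Local Notation locally2 :=
  (@locally (prod_UniformSpace R_UniformSpace R_UniformSpace)) (only parsing).

Lemma shift_0 (Y nu : point) : shift Y 0 nu = Y.
Proof. destruct Y; unfold shift; cbn [fst snd]; now rewrite !Rmult_0_l, !Rplus_0_r. Qed.

Lemma continuous_shift (Y nu : point) :
  filterlim (fun t => shift Y t nu) (locally 0) (locally2 Y).
Proof.
  replace (locally2 Y) with (locally2 (shift Y 0 nu)) by now rewrite shift_0.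
  apply (filterlim_comp_2 (F := locally 0) (fun t => fst Y + t * fst nu)
    (fun t => snd Y + t * snd nu) pair (G := locally (fst Y + 0 * fst nu))
    (H := locally (snd Y + 0 * snd nu))).
  - apply (lim_plus (F := locally 0)); [apply filterlim_const|].
    apply (lim_mult (F := locally 0)); [apply filterlim_id | apply filterlim_const].
  - apply (lim_plus (F := locally 0)); [apply filterlim_const|].
    apply (lim_mult (F := locally 0)); [apply filterlim_id | apply filterlim_const].
  - intros P [d Hd]; exists (ball (fst Y + 0 * fst nu) d) (ball (snd Y + 0 * snd nu) d).
    + apply locally_ball.
    + apply locally_ball.
    + intros x y Hx Hy; apply Hd; split; assumption.
Qed.

Lemma lim_within_weaken (S S' : point -> Prop) (v : point -> R) (X : point) (l : R) :
  (forall Y, S Y -> S' Y) -> lim_within S' v X l -> lim_within S v X l.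
Proof.
  intros HS Hv P HP; specialize (Hv P HP); revert Hv.
  unfold filtermap, within; apply filter_imp; auto.
Qed.

Lemma lim_within_ext (S : point -> Prop) (v w : point -> R) (X : point) (l : R) :
  (forall Y, S Y -> v Y = w Y) -> lim_within S v X l -> lim_within S w X l.
Proof.
  intros HS Hv P HP; specialize (Hv P HP); revert Hv.
  unfold filtermap, within; apply filter_imp; intros Y HY HSY.
  rewrite <- HS; auto.
Qed.

(** A linear function on a box is largest at the corner selected by the signs of its two
    coefficients. *)
Lemma box_corner (P : point -> Prop) (l r b t alpha beta : R) (X : point) :
  P (l, b) -> P (r, b) -> P (r, t) -> P (l, t) -> box l r b t X ->
  exists C, P C /\ alpha * fst X + beta * snd X <= alpha * fst C + beta * snd C.
Proof.
  intros P1 P2 P3 P4 [Hx Hy].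
  destruct (Rle_lt_dec 0 alpha), (Rle_lt_dec 0 beta).
  - exists (r, t); split; [exact P3 | cbn [fst snd]; nra].
  - exists (r, b); split; [exact P2 | cbn [fst snd]; nra].
  - exists (l, t); split; [exact P4 | cbn [fst snd]; nra].
  - exists (l, b); split; [exact P1 | cbn [fst snd]; nra].
Qed.

(** * Nearest points on the curve *)

Section Feet.
Variable G : curve.

Lemma is_foot_le (A : point) (x y : R) : is_foot G A x -> in_param G y ->
  norm2 (minus2 A (G x)) <= norm2 (minus2 A (G y)).
Proof.
  intros [_ E] Hy; rewrite E; unfold dist_curve.
  pose proof (Glb_Rbar_correct
    (fun d => exists xi, in_param G xi /\ d = norm2 (minus2 A (G xi)))) as [Hlb Hglb].
  destruct (Glb_Rbar _) as [g| |]; simpl.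
  - apply (Hlb (norm2 (minus2 A (G y)))); now exists y.
  (* For an infinite bound, [real] returns 0, which is still at most any norm. *)
  - apply sqrt_pos.
  - apply sqrt_pos.
Qed.

Lemma nearest_exists (X : point) :
  exists x, in_param G x /\ forall y, in_param G y ->
    norm2 (minus2 X (G x)) <= norm2 (minus2 X (G y)).
Proof.
  destruct (continuity_ab_min (fun x => norm2 (minus2 X (G x))) (xi_s G) (xi_e G))
    as (x & Hmin & Hx).
  - apply Rlt_le, xi_se.
  - intros x _; apply continuity_pt_filterlim.
    apply (lim_comp (F := locally x) (fun x => dot (minus2 X (G x)) (minus2 X (G x))) sqrt);
      [|apply continuous_sqrt].
    apply lim_plus; apply lim_mult;
      apply (lim_minus (F := locally x)); try apply filterlim_const.
    + exact (continuous_dparam_fst G 0 x ltac:(auto)).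
    + exact (continuous_dparam_fst G 0 x ltac:(auto)).
    + exact (continuous_dparam_snd G 0 x ltac:(auto)).
    + exact (continuous_dparam_snd G 0 x ltac:(auto)).
  - exists x; auto.
Qed.

(** Moving from [x] towards [y] stays in the parameter interval, and the squared distance cannot
    start to decrease. Being an inequality, the condition also holds when [x] is an endpoint. *)
Lemma nearest_first_order (X : point) (x y : R) :
  in_param G x -> in_param G y ->
  (forall z, in_param G z -> norm2 (minus2 X (G x)) <= norm2 (minus2 X (G z))) ->
  (y - x) * tangential G X x <= 0.
Proof.
  intros Hx Hy Hmin.
  set (z := fun t => x + t * (y - x)).
  set (f := fun t => dot (minus2 X (G (z t))) (minus2 X (G (z t)))).
  assert (Hz0 : z 0 = x) by (unfold z; ring).
  assert (Dz : is_derive z 0 (y - x)) by (unfold z; auto_derive; [trivial|ring]).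
  assert (D : is_derive f 0 (-2 * ((y - x) * tangential G X x))).
  { pose proof (is_derive_dparam_fst G 0 (z 0) ltac:(auto)) as F0.
    pose proof (is_derive_dparam_snd G 0 (z 0) ltac:(auto)) as S0.
    pose proof (is_derive_minus _ _ _ _ _ (is_derive_const (fst X) 0)
      (is_derive_comp _ _ _ _ _ F0 Dz)) as F.
    pose proof (is_derive_minus _ _ _ _ _ (is_derive_const (snd X) 0)
      (is_derive_comp _ _ _ _ _ S0 Dz)) as S.
    pose proof (is_derive_plus _ _ _ _ _ (is_derive_mult _ _ _ _ _ F F Rmult_comm)
      (is_derive_mult _ _ _ _ _ S S Rmult_comm)) as H.
    replace (-2 * ((y - x) * tangential G X x)) with
      ((0 - (y - x) * fst (dparam G 1 (z 0))) * (fst X - fst (G (z 0)))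
       + (fst X - fst (G (z 0))) * (0 - (y - x) * fst (dparam G 1 (z 0)))
       + ((0 - (y - x) * snd (dparam G 1 (z 0))) * (snd X - snd (G (z 0)))
          + (snd X - snd (G (z 0))) * (0 - (y - x) * snd (dparam G 1 (z 0)))));
    [exact H | rewrite Hz0; unfold tangential, dot, minus2; cbn [fst snd]; ring]. }
  apply derive_min_nonneg in D; [lra|].
  intros t Ht; unfold f; rewrite Hz0.
  apply sqrt_le_0; [unfold dot; nra | unfold dot; nra |].
  apply (Hmin (z t)); unfold in_param, z in *; nra.
Qed.

Variable eps : R.
Hypothesis Htube : tubular G eps.

(** For [y <> x] the first-order condition at [y] in the direction of [x] has the sign opposite to
    [tangential_sign]. *)
Lemma foot_of_P (eta x y : R) : - eps <= eta <= eps -> in_param G x ->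
  is_foot G (P_G G eta x) y -> y = x.
Proof.
  intros He Hx Hfoot; pose proof Hfoot as [Hy _].
  destruct (Req_dec x y) as [E|E]; [auto|exfalso].
  pose proof (tangential_sign G eps Htube eta x y He Hx Hy E) as H1.
  pose proof (nearest_first_order (P_G G eta x) y x Hy Hx
    (fun z => is_foot_le _ y z Hfoot)) as H2.
  lra.
Qed.

(** * A box with corners in the tube lies in the fictitious element *)

Section Box.
Variables (l r b t h x_min x_max : R).
Hypotheses (Hmin : in_param G x_min) (Hmax : in_param G x_max).
(** The corners are at first only known to lie in the tube, hence the bound [eps] on eta; the
    sharper bound [h] is obtained in [box_in_fictitious]. *)
Let good (C : point) : Prop :=
  exists eta x, - eps <= eta <= eps /\ x_min <= x <= x_max /\ C = P_G G eta x.
Hypotheses (C1 : good (l, b)) (C2 : good (r, b)) (C3 : good (r, t)) (C4 : good (l, t)).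

Let good_param (x : R) : x_min <= x <= x_max -> in_param G x.
Proof. unfold in_param in *; lra. Qed.

(* [tangential _ y] is affine, hence extremal at corners. *)
Let corner_above (X : point) (y : R) : box l r b t X ->
  exists C, good C /\ tangential G X y <= tangential G C y.
Proof.
  intros HX.
  destruct (box_corner good l r b t (fst (dparam G 1 y)) (snd (dparam G 1 y)) X
    C1 C2 C3 C4 HX) as (C & HC & Hle).
  exists C; split; [exact HC|].
  unfold tangential, dot, minus2; cbn [fst snd]; lra.
Qed.

Let corner_below (X : point) (y : R) : box l r b t X ->
  exists C, good C /\ tangential G C y <= tangential G X y.
Proof.
  intros HX.
  destruct (box_corner good l r b t (- fst (dparam G 1 y)) (- snd (dparam G 1 y)) X
    C1 C2 C3 C4 HX) as (C & HC & Hle).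
  exists C; split; [exact HC|].
  unfold tangential, dot, minus2; cbn [fst snd]; lra.
Qed.

Hypothesis Hdiam : forall X Y, box l r b t X -> box l r b t Y -> norm2 (minus2 X Y) <= h.
Hypothesis Hh : h < eps.
Variable X0 : point.
Hypotheses (HX0 : box l r b t X0) (HX0c : on_curve G X0).

Lemma box_in_fictitious (X : point) : box l r b t X ->
  exists eta x, - h <= eta <= h /\ x_min <= x <= x_max /\ X = P_G G eta x.
Proof.
  intros HX.
  destruct (nearest_exists X) as (x & Hx & Hnear).
  (* Otherwise some corner has a tangential value of the same sign at [x]. By [tangential_sign] its
     parameter [y] lies on that side of [x], and moving from [x] towards [y] would bring the curve
     closer to [X]. *)
  assert (E : tangential G X x = 0).
  { destruct (Rtotal_order (tangential G X x) 0) as [Hlt|[E|Hgt]]; [exfalso|exact E|exfalso].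
    - destruct (corner_below X x HX) as (C & (eta & y & He & Hy & ->) & Hle).
      assert (Hyx : y <> x) by (intros ->; rewrite tangential_P in Hle; lra).
      pose proof (tangential_sign G eps Htube eta y x He (good_param y Hy) Hx Hyx).
      pose proof (nearest_first_order X x y Hx (good_param y Hy) Hnear); nra.
    - destruct (corner_above X x HX) as (C & (eta & y & He & Hy & ->) & Hle).
      assert (Hyx : y <> x) by (intros ->; rewrite tangential_P in Hle; lra).
      pose proof (tangential_sign G eps Htube eta y x He (good_param y Hy) Hx Hyx).
      pose proof (nearest_first_order X x y Hx (good_param y Hy) Hnear); nra. }
  pose proof (P_of_tangential G X x Hx E) as EX.
  set (eta := dot (minus2 X (G x)) (normal G x)) in *.
  exists eta, x; split; [|split; [|exact EX]].
  (* [Rabs eta] is the distance from [X] to its nearest curve point, hence at most the distance to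
     [X0], a curve point in the same box. *)
  - apply Rabs_le_between.
    rewrite <- (norm2_P G eta x Hx), <- EX.
    destruct HX0c as (s & Hs & <-).
    apply Rle_trans with (norm2 (minus2 X (G s))); [apply Hnear; exact Hs|].
    apply Hdiam; assumption.
  (* If [x] were outside [[x_min, x_max]], all corners would lie strictly on one side of the normal
     line at [x], whereas [X] is on that line. *)
  - split; apply Rnot_lt_le; intros Hlt.
    + destruct (corner_below X x HX) as (C & (eta' & y & He & Hy & ->) & Hle).
      pose proof (tangential_sign G eps Htube eta' y x He (good_param y Hy) Hx ltac:(lra)).
      nra.
    + destruct (corner_above X x HX) as (C & (eta' & y & He & Hy & ->) & Hle).
      pose proof (tangential_sign G eps Htube eta' y x He (good_param y Hy) Hx ltac:(lra)).
      nra.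
Qed.

(** If all corners shared one normal line, two perpendicular sides of the box would both be
    orthogonal to [g'], forcing [g' = 0]. This makes the interval of integration in the weak
    conditions nondegenerate. *)
Lemma feet_distinct : l < r -> b < t -> x_min < x_max.
Proof.
  intros Hlr Hbt.
  assert (Hle : x_min <= x_max) by (destruct C1 as (? & ? & ? & ? & ?); lra).
  destruct Hle as [H|E]; [exact H|exfalso].
  assert (H : forall C, good C -> tangential G C x_min = 0).
  { intros C (eta & x & _ & Hx & ->); replace x with x_min by lra.
    apply tangential_P. }
  pose proof (speed_pos G x_min Hmin) as HS; pose proof (speed_sqr G x_min) as HS2.
  pose proof (H _ C1) as H1; pose proof (H _ C2) as H2; pose proof (H _ C4) as H3.
  unfold tangential, dot, minus2 in H1, H2, H3; cbn [fst snd] in H1, H2, H3.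
  assert (E1 : (r - l) * fst (dparam G 1 x_min) = 0) by lra.
  assert (E2 : (t - b) * snd (dparam G 1 x_min) = 0) by lra.
  apply Rmult_integral in E1; apply Rmult_integral in E2.
  destruct E1 as [E1|E1]; [lra|]; destruct E2 as [E2|E2]; [lra|].
  rewrite E1, E2 in HS2; nra.
Qed.

End Box.

(** * Continuity and differentiability of the tubular coordinates *)

Variable RG : point -> R * R.
Hypothesis HRG : is_tube_inverse G eps RG.

Lemma lim_tangential (A : point) (y : R) :
  filterlim (fun X => tangential G X y) (locally2 A) (locally (tangential G A y)).
Proof.
  apply lim_plus; apply lim_mult; try apply filterlim_const;
    apply lim_minus; try apply filterlim_const.
  - exact (@continuous_fst R_UniformSpace R_UniformSpace (fst A) (snd A)).
  - exact (@continuous_snd R_UniformSpace R_UniformSpace (fst A) (snd A)).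
Qed.

(** Within the tube the side of [y] is read off from the sign of [tangential], which is continuous
    in the point; a strict sign at [A] therefore persists nearby. *)
Lemma foot_same_side (A : point) (y : R) :
  in_tube G eps A -> in_param G y -> snd (RG A) <> y ->
  within (in_tube G eps) (locally2 A)
    (fun X => 0 < (snd (RG A) - y) * (snd (RG X) - y)).
Proof.
  intros HA Hy Hne.
  destruct (in_tube_coordinates G eps A RG HRG HA) as (He & Hx & EA).
  pose proof (tangential_sign G eps Htube _ _ y He Hx Hy Hne) as Hs; rewrite EA in Hs.
  assert (Hlim : filterlim (fun X => (snd (RG A) - y) * tangential G X y) (locally2 A)
    (locally ((snd (RG A) - y) * tangential G A y))).
  { apply lim_mult; [apply filterlim_const | apply lim_tangential]. }
  generalize (lim_gt0 _ _ Hlim Hs); unfold within; apply filter_imp; intros X HXs HX.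
  destruct (in_tube_coordinates G eps X RG HRG HX) as (He' & Hx' & EX).
  destruct (Req_dec (snd (RG X)) y) as [E|E].
  - rewrite <- EX, E, tangential_P in HXs; lra.
  - pose proof (tangential_sign G eps Htube _ _ y He' Hx' Hy E) as H; rewrite EX in H.
    set (T := tangential G X y) in *; set (u := snd (RG A) - y) in *.
    set (v := snd (RG X) - y) in *.
    (* [u * T] and [v * T] are positive, so their product [(u * v) * (T * T)] is too. *)
    assert (HT : 0 < T * T) by (destruct (Req_dec T 0) as [->|]; nra).
    assert (H' : 0 < (u * v) * (T * T)).
    { replace (u * v * (T * T)) with ((u * T) * (v * T)) by ring.
      now apply Rmult_lt_0_compat. }
    apply Rmult_lt_reg_r with (T * T); [exact HT | lra].
Qed.

(** The foot is squeezed between [x - e] and [x + e] by [foot_same_side]. A bound that falls beyond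
    an end of the parameter interval holds automatically. *)
Lemma lim_foot (A : point) : in_tube G eps A ->
  filterlim (fun X => snd (RG X)) (within (in_tube G eps) (locally2 A))
    (locally (snd (RG A))).
Proof.
  intros HA; apply filterlim_locally; intros [e He]; cbn [pos].
  destruct (in_tube_coordinates G eps A RG HRG HA) as (_ & Hx & _).
  set (x := snd (RG A)) in *.
  assert (Hup : within (in_tube G eps) (locally2 A) (fun X => snd (RG X) < x + e)).
  { destruct (Rle_lt_dec (x + e) (xi_e G)) as [Hle|Hlt].
    - assert (Hy : in_param G (x + e)) by (unfold in_param in *; lra).
      generalize (foot_same_side A (x + e) HA Hy ltac:(fold x; lra)).
      unfold within; apply filter_imp; intros X HX HXt; specialize (HX HXt); fold x in HX; nra.
    - unfold within; apply filter_forall; intros X HXt.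
      destruct (in_tube_coordinates G eps X RG HRG HXt) as (_ & Hx' & _).
      unfold in_param in Hx'; lra. }
  assert (Hlo : within (in_tube G eps) (locally2 A) (fun X => x - e < snd (RG X))).
  { destruct (Rle_lt_dec (xi_s G) (x - e)) as [Hle|Hlt].
    - assert (Hy : in_param G (x - e)) by (unfold in_param in *; lra).
      generalize (foot_same_side A (x - e) HA Hy ltac:(fold x; lra)).
      unfold within; apply filter_imp; intros X HX HXt; specialize (HX HXt); fold x in HX; nra.
    - unfold within; apply filter_forall; intros X HXt.
      destruct (in_tube_coordinates G eps X RG HRG HXt) as (_ & Hx' & _).
      unfold in_param in Hx'; lra. }
  generalize (filter_and _ _ Hup Hlo); apply filter_imp; intros X [H1 H2].
  change (Rabs (snd (RG X) - x) < e); apply Rabs_lt_between; lra.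
Qed.

Lemma continuous_normal (x : R) : in_param G x ->
  continuous (fun t => fst (normal G t)) x /\ continuous (fun t => snd (normal G t)) x.
Proof.
  intros Hx; destruct (is_derive_normal G x Hx) as [H1 H2].
  split; apply (ex_derive_continuous (K := R_AbsRing) (V := R_NormedModule));
    eexists; eassumption.
Qed.

Lemma lim_offset (A : point) : in_tube G eps A ->
  filterlim (fun X => fst (RG X)) (within (in_tube G eps) (locally2 A))
    (locally (fst (RG A))).
Proof.
  intros HA.
  destruct (in_tube_coordinates G eps A RG HRG HA) as (He & Hx & EA).
  assert (HE : forall X, in_tube G eps X -> fst (RG X)
    = dot (minus2 X (G (snd (RG X)))) (normal G (snd (RG X)))).
  { intros X HX; destruct (in_tube_coordinates G eps X RG HRG HX) as (_ & Hx' & EX).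
    rewrite <- EX at 2; now rewrite eta_of_P. }
  apply (lim_within_ext (in_tube G eps)
    (fun X => dot (minus2 X (G (snd (RG X)))) (normal G (snd (RG X)))));
    [intros X HX; symmetry; auto|].
  rewrite (HE A HA).
  pose proof (lim_foot A HA) as Hf.
  destruct (continuous_normal _ Hx) as [N1 N2].
  assert (Hle : filter_le (within (in_tube G eps) (locally2 A)) (locally2 A))
    by (apply filter_le_within; apply locally_filter).
  unfold lim_within, dot, minus2; cbn [fst snd].
  apply lim_plus; apply lim_mult; try apply lim_minus.
  - apply (filterlim_filter_le_1 _ Hle).
    exact (@continuous_fst R_UniformSpace R_UniformSpace (fst A) (snd A)).
  - exact (lim_comp _ _ _ Hf (continuous_dparam_fst G 0 _ ltac:(auto))).
  - exact (lim_comp _ _ _ Hf N1).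
  - apply (filterlim_filter_le_1 _ Hle).
    exact (@continuous_snd R_UniformSpace R_UniformSpace (fst A) (snd A)).
  - exact (lim_comp _ _ _ Hf (continuous_dparam_snd G 0 _ ltac:(auto))).
  - exact (lim_comp _ _ _ Hf N2).
Qed.

(** The derivative of the parameter xi in the direction [nu] at the point with coordinates
    [(eta, x)]. *)
Definition foot_slope (nu : point) (eta x : R) : R :=
  dot nu (dparam G 1 x) / (speed G x * speed G x * (1 + eta * curvature G x)).

(** The equation of the foot of [Y + t nu] is [tangential G Y z + t * (nu . g'(z)) = 0], linear in
    [t] and thus of the form treated by [is_derive_implicit]. *)
Lemma is_derive_foot (Y nu : point) :
  locally 0 (fun t => in_tube G eps (shift Y t nu)) ->
  is_derive (fun t => snd (RG (shift Y t nu))) 0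
    (foot_slope nu (fst (RG Y)) (snd (RG Y))).
Proof.
  intros HY; pose proof (locally_singleton _ _ HY) as HY0; cbv beta in HY0; rewrite shift_0 in HY0.
  destruct (in_tube_coordinates G eps Y RG HRG HY0) as (He & Hx & EY).
  pose proof (tube_curvature G eps Htube _ _ He Hx) as Hk.
  pose proof (speed_pos G _ Hx) as HS.
  set (eta := fst (RG Y)) in *; set (x := snd (RG Y)) in *.
  assert (Hl : - (speed G x * speed G x) * (1 + eta * curvature G x) <> 0).
  { apply Rmult_integral_contrapositive; split; [nra | exact Hk]. }
  pose proof (is_derive_implicit (tangential G Y) (fun z => dot nu (dparam G 1 z))
    (fun t => snd (RG (shift Y t nu)))
    (- (speed G x * speed G x) * (1 + eta * curvature G x))) as H.
  cbv beta in H; rewrite shift_0 in H; fold x in H.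
  replace (foot_slope nu eta x) with (- dot nu (dparam G 1 x) /
    (- (speed G x * speed G x) * (1 + eta * curvature G x)));
    [|unfold foot_slope; field; repeat split; lra].
  apply H.
  - rewrite <- EY; now apply is_derive_tangential_P.
  - exact Hl.
  - apply filterlim_locally; intros e; rewrite shift_0.
    pose proof (proj1 (filterlim_locally _ _) (lim_foot Y HY0) e) as Hlim.
    apply (continuous_shift Y nu) in Hlim; unfold filtermap in Hlim.
    generalize (filter_and _ _ Hlim HY); apply filter_imp; intros t [H1 H2]; auto.
  - apply (lim_plus (F := locally x)); apply (lim_mult (F := locally x));
      try apply filterlim_const.
    + exact (continuous_dparam_fst G 1 x ltac:(auto)).
    + exact (continuous_dparam_snd G 1 x ltac:(auto)).
  - revert HY; apply filter_imp; intros t Ht.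
    destruct (in_tube_coordinates G eps _ RG HRG Ht) as (_ & _ & Et).
    pose proof (tangential_P G eta x) as E0; rewrite EY in E0; rewrite E0.
    pose proof (tangential_P G (fst (RG (shift Y t nu))) (snd (RG (shift Y t nu)))) as E1.
    rewrite Et in E1; rewrite <- E1.
    set (y := snd (RG (shift Y t nu))).
    unfold tangential, dot, minus2, shift; cbn [fst snd]; ring.
Qed.

(** Differentiating [(X - g(xi)) . n(xi)], the motion of the foot contributes only multiples of
    [n . g'], because [n'] is parallel to [g']. *)
Lemma is_derive_offset (Y nu : point) :
  locally 0 (fun t => in_tube G eps (shift Y t nu)) ->
  is_derive (fun t => fst (RG (shift Y t nu))) 0 (dot nu (normal G (snd (RG Y)))).
Proof.
  intros HY; pose proof (locally_singleton _ _ HY) as HY0; cbv beta in HY0; rewrite shift_0 in HY0.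
  destruct (in_tube_coordinates G eps Y RG HRG HY0) as (He & Hx & EY).
  pose proof (is_derive_foot Y nu HY) as Dx.
  set (eta := fst (RG Y)) in *; set (x := snd (RG Y)) in *.
  set (d := foot_slope nu eta x) in *.
  set (z := fun t => snd (RG (shift Y t nu))) in *.
  assert (Hz0 : z 0 = x) by (unfold z; now rewrite shift_0).
  apply (is_derive_ext_loc (fun t =>
    (fst Y + t * fst nu - fst (G (z t))) * fst (normal G (z t))
    + (snd Y + t * snd nu - snd (G (z t))) * snd (normal G (z t)))).
  { revert HY; apply filter_imp; intros t Ht.
    destruct (in_tube_coordinates G eps _ RG HRG Ht) as (_ & Hx' & Et).
    pose proof (eta_of_P G (fst (RG (shift Y t nu))) (z t) Hx') as E.
    unfold z at 1 in E; rewrite Et in E; exact E. }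
  destruct (is_derive_normal G x Hx) as [N1 N2].
  rewrite <- Hz0 in N1, N2.
  pose proof (is_derive_comp _ _ _ _ _ N1 Dx) as DN1.
  pose proof (is_derive_comp _ _ _ _ _ N2 Dx) as DN2.
  pose proof (is_derive_comp _ _ _ _ _
    (is_derive_dparam_fst G 0 (z 0) ltac:(auto)) Dx) as DG1.
  pose proof (is_derive_comp _ _ _ _ _
    (is_derive_dparam_snd G 0 (z 0) ltac:(auto)) Dx) as DG2.
  assert (DL1 : is_derive (fun t => fst Y + t * fst nu) 0 (fst nu))
    by (auto_derive; [trivial|ring]).
  assert (DL2 : is_derive (fun t => snd Y + t * snd nu) 0 (snd nu))
    by (auto_derive; [trivial|ring]).
  pose proof (is_derive_plus _ _ _ _ _
    (is_derive_mult _ _ _ _ _ (is_derive_minus _ _ _ _ _ DL1 DG1) DN1 Rmult_comm)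
    (is_derive_mult _ _ _ _ _ (is_derive_minus _ _ _ _ _ DL2 DG2) DN2 Rmult_comm)) as H.
  replace (dot nu (normal G x)) with
    ((fst nu - d * fst (dparam G 1 (z 0))) * fst (normal G (z 0))
     + (fst Y + 0 * fst nu - fst (G (z 0))) * (d * (curvature G (z 0) * fst (dparam G 1 (z 0))))
     + ((snd nu - d * snd (dparam G 1 (z 0))) * snd (normal G (z 0))
        + (snd Y + 0 * snd nu - snd (G (z 0))) * (d * (curvature G (z 0) * snd (dparam G 1 (z 0))))));
    [exact H|].
  rewrite Hz0, <- EY.
  pose proof (normal_orth G x) as HO; unfold dot in HO.
  unfold dot, P_G, shift; cbn [fst snd].
  (* The added term collects the foot's contribution as a multiple of [n . g' = 0]. *)
  match goal with |- _ = ?rhs =>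
    transitivity (rhs + (d * curvature G x * eta - d) *
      (fst (normal G x) * fst (dparam G 1 x) + snd (normal G x) * snd (dparam G 1 x)))
  end; [ring | rewrite HO; ring].
Qed.

(** * One-sided traces and fluxes *)

Section OneSide.
(** [S] will be one side of the closed cell, where [phi] is the polynomial [p] in tubular
    coordinates. [U] will be the same side of the open cell, where short segments in every direction
    stay in [S]. *)
Variables (S U : point -> Prop) (phi : point -> R) (m : nat)
  (c : nat -> nat -> R) (p : R -> R -> R).
Hypothesis Hp : forall eta xi,
  p eta xi = sum_n (fun i => sum_n (fun j => c i j * eta ^ i * xi ^ j) m) m.
Hypothesis HSt : forall Y, S Y -> in_tube G eps Y.
Hypothesis HSphi : forall Y, S Y -> phi Y = p (fst (RG Y)) (snd (RG Y)).
Hypothesis HU : forall Y, U Y -> locally2 Y S.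

Lemma one_sided_trace (X : point) : in_tube G eps X ->
  lim_within S phi X (p (fst (RG X)) (snd (RG X))).
Proof.
  intros HX.
  apply (lim_within_ext S (fun Y => p (fst (RG Y)) (snd (RG Y))));
    [intros; symmetry; auto|].
  apply (lim_within_weaken S (in_tube G eps)); [exact HSt|].
  exact (lim_Qm _ _ _ _ (lim_offset X HX) (lim_foot X HX) m c p Hp).
Qed.

Definition slope (nu : point) (eta x : R) : R :=
  dQ_eta m c eta x * dot nu (normal G x) + dQ_xi m c eta x * foot_slope nu eta x.

Lemma is_derive_one_sided (Y nu : point) : U Y ->
  is_derive (fun t => phi (shift Y t nu)) 0 (slope nu (fst (RG Y)) (snd (RG Y))).
Proof.
  intros HY.
  assert (HS : locally 0 (fun t => S (shift Y t nu))) by exact (continuous_shift Y nu S (HU Y HY)).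
  assert (HT : locally 0 (fun t => in_tube G eps (shift Y t nu)))
    by (revert HS; apply filter_imp; auto).
  apply (is_derive_ext_loc (fun t =>
    p (fst (RG (shift Y t nu))) (snd (RG (shift Y t nu))))).
  { revert HS; apply filter_imp; intros t Ht; symmetry; auto. }
  pose proof (is_derive_Qm m c p _ _ 0 _ _ Hp (is_derive_offset Y nu HT)
    (is_derive_foot Y nu HT)) as H.
  cbv beta in H; rewrite shift_0 in H; exact H.
Qed.

(** The direction [normal G s] stays fixed while the point tends to [G s], so the directional
    derivative involves both partial derivatives and only its limit is purely in eta. *)
Lemma one_sided_flux (s : R) : in_param G s ->
  lim_within U (dir_derive phi (normal G s)) (G s) (d_eta 1 p 0 s).
Proof.
  intros Hs; pose proof (tube_pos G eps Htube) as Heps.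
  pose proof (speed_pos G s Hs) as HS.
  assert (EG : P_G G 0 s = G s) by apply shift_0.
  assert (HT : in_tube G eps (G s)) by (exists 0, s; repeat split; try lra; auto; apply Hs).
  assert (ER : RG (G s) = (0, s)) by (rewrite <- EG; apply HRG; [lra | exact Hs]).
  apply (lim_within_ext U (fun Y => slope (normal G s) (fst (RG Y)) (snd (RG Y)))).
  { intros Y HY; symmetry; apply is_derive_unique; now apply is_derive_one_sided. }
  apply (lim_within_weaken U (in_tube G eps)).
  { intros Y HY; apply HSt; exact (locally_singleton _ _ (HU Y HY)). }
  (* At the limit point [n . n = 1] and [n . g' = 0], which removes the xi-derivative. *)
  assert (E0 : d_eta 1 p 0 s = slope (normal G s) 0 s).
  { rewrite (d_eta_Qm m c p 0 s Hp); unfold slope, foot_slope.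
    rewrite normal_unit, normal_orth by exact Hs; unfold Rdiv; ring. }
  rewrite E0; pose proof (lim_offset _ HT) as Hu; pose proof (lim_foot _ HT) as Hv.
  rewrite ER in Hu, Hv; cbn [fst snd] in Hu, Hv.
  destruct (continuous_normal s Hs) as [N1 N2].
  pose proof (lim_comp _ _ _ Hv (continuous_speed G s)) as Hsp.
  unfold lim_within, slope, foot_slope; apply lim_plus; apply lim_mult.
  - exact (lim_dQ_eta _ _ _ _ Hu Hv m c).
  - unfold dot; apply lim_plus; apply lim_mult; try apply filterlim_const.
    + exact (lim_comp _ _ _ Hv N1).
    + exact (lim_comp _ _ _ Hv N2).
  - exact (lim_dQ_xi _ _ _ _ Hu Hv m c).
  - apply lim_mult.
    + unfold dot; apply lim_plus; apply lim_mult; try apply filterlim_const.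
      * exact (lim_comp _ _ _ Hv (continuous_dparam_fst G 1 s ltac:(auto))).
      * exact (lim_comp _ _ _ Hv (continuous_dparam_snd G 1 s ltac:(auto))).
    + apply lim_inv; [rewrite Rmult_0_l; nra|].
      apply lim_mult; [now apply lim_mult|].
      apply lim_plus; [apply filterlim_const|].
      apply lim_mult; [exact Hu|].
      exact (lim_comp _ _ _ Hv (continuous_curvature G s Hs)).
Qed.

End OneSide.
End Feet.

(** * The mesh *)

Section MeshGeometry.
Variable M : mesh.

Lemma h_x_pos : 0 < h_x M.
Proof.
  apply Rdiv_lt_0_compat; [pose proof (x_lr M); lra | apply lt_0_INR, n_x_pos].
Qed.

Lemma h_y_pos : 0 < h_y M.
Proof.
  apply Rdiv_lt_0_compat; [pose proof (y_bt M); lra | apply lt_0_INR, n_y_pos].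
Qed.

Lemma cell_diameter (i j : nat) (X Y : point) :
  cell M i j X -> cell M i j Y -> norm2 (minus2 X Y) <= diameter M.
Proof.
  pose proof h_x_pos; pose proof h_y_pos.
  unfold cell, box, vertex; cbn [fst snd]; rewrite !S_INR.
  intros [X1 X2] [Y1 Y2]; apply sqrt_le_1_alt.
  unfold dot, minus2; cbn [fst snd]; nra.
Qed.

Lemma cell_domain (i j : nat) (X : point) :
  (i < n_x M)%nat -> (j < n_y M)%nat -> cell M i j X -> Defs.domain M X.
Proof.
  intros Hi Hj; pose proof h_x_pos as Hx; pose proof h_y_pos as Hy.
  assert (Ex : INR (n_x M) * h_x M = x_r M - x_l M).
  { unfold h_x; field; apply not_0_INR; lia. }
  assert (Ey : INR (n_y M) * h_y M = y_t M - y_b M).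
  { unfold h_y; field; apply not_0_INR; lia. }
  apply le_INR in Hi; apply le_INR in Hj.
  pose proof (pos_INR i); pose proof (pos_INR j).
  unfold cell, Defs.domain, box, vertex; cbn [fst snd].
  intros [X1 X2]; nra.
Qed.

Lemma cell_interior_open (i j : nat) (X : point) :
  cell_interior M i j X -> locally2 X (cell M i j).
Proof.
  intros [[H1 H2] [H3 H4]].
  pose proof (@continuous_fst R_UniformSpace R_UniformSpace (fst X) (snd X)) as Cf.
  pose proof (@continuous_snd R_UniformSpace R_UniformSpace (fst X) (snd X)) as Cs.
  destruct X as [X1 X2]; cbn [fst snd] in *.
  apply open_gt in H1; apply open_lt in H2; apply open_gt in H3; apply open_lt in H4.
  apply Cf in H1; apply Cf in H2; apply Cs in H3; apply Cs in H4.
  unfold filtermap in H1, H2, H3, H4.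
  generalize (filter_and _ _ (filter_and _ _ H1 H2) (filter_and _ _ H3 H4)).
  apply filter_imp; intros Y [[E1 E2] [E3 E4]].
  repeat split; apply Rlt_le; assumption.
Qed.

End MeshGeometry.

(** * Transfer of the interface conditions to the mesh cell *)

Theorem lemma2 (M : mesh) (G : curve) (Omp Omm : point -> Prop)
  (bp bm : R) (beta : point -> R) (m : nat) (eps : R)
  (RG : point -> R * R) (i j : nat) (xi1 xi2 xi3 xi4 : R)
  (phi : point -> R)
  (Hdiv : divides M G Omp Omm)
  (Hbp : 0 < bp) (Hbm : 0 < bm)
  (Hbeta_p : forall X, Omp X -> beta X = bp)
  (Hbeta_m : forall X, Omm X -> beta X = bm)
  (Hm : (1 <= m)%nat)
  (Htube : tubular G eps)
  (HRG : is_tube_inverse G eps RG)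
  (Hh : diameter M < eps)
  (HK : interface_element M G i j)
  (Hv1 : in_tube G eps (vertex M i j))
  (Hv2 : in_tube G eps (vertex M (S i) j))
  (Hv3 : in_tube G eps (vertex M (S i) (S j)))
  (Hv4 : in_tube G eps (vertex M i (S j)))
  (Hxi1 : is_foot G (vertex M i j) xi1)
  (Hxi2 : is_foot G (vertex M (S i) j) xi2)
  (Hxi3 : is_foot G (vertex M (S i) (S j)) xi3)
  (Hxi4 : is_foot G (vertex M i (S j)) xi4)
  (Horient : forall eta xi, - eps <= eta <= eps -> in_param G xi ->
     cell M i j (P_G G eta xi) ->
     (0 < eta -> Omp (P_G G eta xi)) /\ (eta < 0 -> Omm (P_G G eta xi)))
  (Hphi : V_K G m bp bm (diameter M)
     (Rmin (Rmin xi1 xi2) (Rmin xi3 xi4))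
     (Rmax (Rmax xi1 xi2) (Rmax xi3 xi4)) RG (cell M i j) phi) :
  (forall X, cell M i j X -> on_curve G X ->
     is_jump (fun Y => cell M i j Y /\ Omp Y)
             (fun Y => cell M i j Y /\ Omm Y) phi X 0)
  /\
  (forall s, in_param G s -> cell M i j (G s) ->
     (forall Y, cell_interior M i j Y -> ~ on_curve G Y ->
        ex_dir_derive phi (normal G s) Y) /\
     is_jump (fun Y => cell_interior M i j Y /\ Omp Y)
             (fun Y => cell_interior M i j Y /\ Omm Y)
             (fun Y => beta Y * dir_derive phi (normal G s) Y) (G s) 0).
Proof.
  destruct HK as (Hi & Hj & X0 & HX0i & HX0c).
  set (a := Rmin (Rmin xi1 xi2) (Rmin xi3 xi4)) in *.
  set (b := Rmax (Rmax xi1 xi2) (Rmax xi3 xi4)) in *.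
  pose proof (tube_pos G eps Htube) as Heps.
  assert (Ha : a <= xi1 /\ a <= xi2 /\ a <= xi3 /\ a <= xi4 /\ in_param G a).
  { destruct Hxi1 as [I1 _], Hxi2 as [I2 _], Hxi3 as [I3 _], Hxi4 as [I4 _].
    unfold in_param, a, Rmin in *; repeat destruct Rle_dec; lra. }
  assert (Hb : xi1 <= b /\ xi2 <= b /\ xi3 <= b /\ xi4 <= b /\ in_param G b).
  { destruct Hxi1 as [I1 _], Hxi2 as [I2 _], Hxi3 as [I3 _], Hxi4 as [I4 _].
    unfold in_param, b, Rmax in *; repeat destruct Rle_dec; lra. }
  (* The foot of a vertex is its own fibre parameter, so the bounds on the four feet bound the
     coordinates of the corners. *)
  assert (Hcorner : forall C x, in_tube G eps C -> is_foot G C x -> a <= x <= b ->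
    exists eta x, - eps <= eta <= eps /\ a <= x <= b /\ C = P_G G eta x).
  { intros C x (eta & y & He & Hy & ->) Hfoot Hx.
    exists eta, y; rewrite (foot_of_P G eps Htube eta y x He Hy Hfoot) in Hx; auto. }
  pose proof (Hcorner _ _ Hv1 Hxi1 ltac:(lra)) as G1.
  pose proof (Hcorner _ _ Hv2 Hxi2 ltac:(lra)) as G2.
  pose proof (Hcorner _ _ Hv3 Hxi3 ltac:(lra)) as G3.
  pose proof (Hcorner _ _ Hv4 Hxi4 ltac:(lra)) as G4.
  assert (Hab : a < b).
  { apply (feet_distinct G eps _ _ _ _ a b (proj2 (proj2 (proj2 (proj2 Ha)))) G1 G2 G4);
      unfold vertex; cbn [fst snd]; rewrite S_INR;
      pose proof (h_x_pos M); pose proof (h_y_pos M); lra. }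
  assert (HX0 : cell M i j X0) by exact (locally_singleton _ _ (cell_interior_open M i j X0 HX0i)).
  assert (Hcell : forall X, cell M i j X -> - diameter M <= fst (RG X) <= diameter M /\
    a <= snd (RG X) <= b /\ P_G G (fst (RG X)) (snd (RG X)) = X).
  { intros X HX.
    destruct (box_in_fictitious G eps Htube _ _ _ _ (diameter M) a b
      (proj2 (proj2 (proj2 (proj2 Ha)))) (proj2 (proj2 (proj2 (proj2 Hb))))
      G1 G2 G3 G4 (cell_diameter M i j) X0 HX0 HX0c X HX) as (eta & x & He & Hx & ->).
    rewrite HRG; [auto | lra | unfold in_param in *; lra]. }
  assert (Hparam : forall x, a <= x <= b -> in_param G x) by (unfold in_param in *; intros; lra).
  assert (Htubecell : forall X, cell M i j X -> in_tube G eps X).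
  { intros X HX; destruct (Hcell X HX) as (He & Hx & E).
    exists (fst (RG X)), (snd (RG X)); repeat split; auto; try lra; now apply Hparam. }
  destruct Hphi as (phih & (pp & pm & HQp & HQm & Hval & Hweak) & HphiK).
  assert (Hjump : forall x, a <= x <= b -> pp 0 x = pm 0 x).
  { intros x Hx.
    set (q := fun x => jump0 pp pm x).
    assert (Hq : is_Pm m q).
    { apply (is_Pm_lin m 1 (-1) (pp 0) (pm 0)); try now apply is_Qm_trace.
      intros y; unfold q, jump0; ring. }
    pose proof (weak_jump_eq_0 m q a b Hab Hq (proj1 (Hweak q Hq)) x Hx) as H.
    unfold q, jump0 in H; lra. }
  assert (Hflux : forall x, a <= x <= b -> bp * d_eta 1 pp 0 x = bm * d_eta 1 pm 0 x).
  { intros x Hx.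
    set (q := fun x => jump0 (fun e x => bp * d_eta 1 pp e x)
              (fun e x => bm * d_eta 1 pm e x) x).
    assert (Hq : is_Pm m q).
    { apply (is_Pm_lin m bp (- bm) (d_eta 1 pp 0) (d_eta 1 pm 0));
        try now apply is_Qm_flux_trace.
      intros y; unfold q, jump0; ring. }
    pose proof (weak_jump_eq_0 m q a b Hab Hq (proj1 (proj2 (Hweak q Hq))) x Hx) as H.
    unfold q, jump0 in H; lra. }
  assert (Hdom : forall X, cell M i j X -> Defs.domain M X)
    by (intros X; exact (cell_domain M i j X Hi Hj)).
  assert (Hoff : forall X, cell M i j X -> Omp X \/ Omm X -> fst (RG X) <> 0).
  { intros X HX HO E; destruct (Hcell X HX) as (_ & Hx & EX).
    apply (div_cover M G Omp Omm Hdiv) in HO; destruct HO as [_ HO]; apply HO.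
    exists (snd (RG X)); split; [now apply Hparam|].
    rewrite E in EX; rewrite <- EX at 2; symmetry; apply shift_0. }
  (* With negative eta the orientation would put the point in [Omm] as well, against
     disjointness. *)
  assert (Hp : forall X, cell M i j X /\ Omp X -> phi X = pp (fst (RG X)) (snd (RG X))).
  { intros X [HX HO]; destruct (Hcell X HX) as (He & Hx & EX).
    rewrite (HphiK X HX); apply (Hval _ _ He Hx).
    apply Rnot_lt_le; intros Hlt; apply (div_disjoint M G Omp Omm Hdiv X).
    split; [exact HO|].
    rewrite <- EX in HX |- *.
    apply (Horient (fst (RG X)) (snd (RG X)) ltac:(lra) (Hparam _ Hx) HX); exact Hlt. }
  assert (Hm' : forall X, cell M i j X /\ Omm X -> phi X = pm (fst (RG X)) (snd (RG X))).
  { intros X [HX HO]; destruct (Hcell X HX) as (He & Hx & EX).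
    rewrite (HphiK X HX); apply (Hval _ _ He Hx).
    (* The case [eta = 0] must be excluded on this side, because there [phih] takes the values of
       [pp]. *)
    pose proof (Hoff X HX (or_intror HO)) as Hne.
    apply Rnot_le_lt; intros Hle; apply (div_disjoint M G Omp Omm Hdiv X).
    split; [|exact HO].
    rewrite <- EX in HX |- *.
    apply (Horient (fst (RG X)) (snd (RG X)) ltac:(lra) (Hparam _ Hx) HX); lra. }
  (* [Omp] is open only relative to the domain; near an interior point of the cell, [Hdom] supplies
     membership in the domain. *)
  assert (Hpo : forall X, cell_interior M i j X /\ Omp X ->
    locally2 X (fun Y => cell M i j Y /\ Omp Y)).
  { intros X [HX HO].
    generalize (filter_and _ _ (cell_interior_open M i j X HX)
      (div_open_p M G Omp Omm Hdiv X HO)).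
    apply filter_imp; intros Y [H1 H2]; auto. }
  assert (Hmo : forall X, cell_interior M i j X /\ Omm X ->
    locally2 X (fun Y => cell M i j Y /\ Omm Y)).
  { intros X [HX HO].
    generalize (filter_and _ _ (cell_interior_open M i j X HX)
      (div_open_m M G Omp Omm Hdiv X HO)).
    apply filter_imp; intros Y [H1 H2]; auto. }
  assert (Htp : forall X, cell M i j X /\ Omp X -> in_tube G eps X) by (intros X []; auto).
  assert (Htm : forall X, cell M i j X /\ Omm X -> in_tube G eps X) by (intros X []; auto).
  assert (Hcurve : forall s, in_param G s -> cell M i j (G s) ->
    RG (G s) = (0, s) /\ a <= s <= b).
  { intros s Hs Hc.
    assert (E : RG (G s) = (0, s)).
    { rewrite <- (HRG 0 s); [|lra|exact Hs]; f_equal; symmetry; apply shift_0. }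
    destruct (Hcell _ Hc) as (_ & Hx & _); rewrite E in Hx; auto. }
  destruct HQp as [cp HQp], HQm as [cm HQm].
  split.
  - intros X HX (s & Hs & <-).
    destruct (Hcurve s Hs HX) as [E Hsab].
    exists (pp 0 s), (pm 0 s); split; [|split].
    + pose proof (one_sided_trace G eps Htube RG HRG _ phi m cp pp HQp Htp Hp
        (G s) (Htubecell _ HX)) as H; rewrite E in H; exact H.
    + pose proof (one_sided_trace G eps Htube RG HRG _ phi m cm pm HQm Htm Hm'
        (G s) (Htubecell _ HX)) as H; rewrite E in H; exact H.
    + rewrite Hjump by exact Hsab; ring.
  - intros s Hs Hc; destruct (Hcurve s Hs Hc) as [_ Hsab]; split.
    + intros Y HY HnY.
      pose proof (locally_singleton _ _ (cell_interior_open M i j Y HY)) as HYc.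
      (* A point off the curve belongs to one of the two sides, on which [phi] is a single
         polynomial in smooth coordinates. *)
      destruct (proj1 (div_cover M G Omp Omm Hdiv Y) (conj (Hdom Y HYc) HnY)) as [HO|HO];
        eexists.
      * exact (is_derive_one_sided G eps Htube RG HRG _ _ phi m cp pp HQp Htp Hp Hpo
          Y _ (conj HY HO)).
      * exact (is_derive_one_sided G eps Htube RG HRG _ _ phi m cm pm HQm Htm Hm' Hmo
          Y _ (conj HY HO)).
    + exists (bp * d_eta 1 pp 0 s), (bm * d_eta 1 pm 0 s); split; [|split].
      * apply (lim_within_ext _ (fun Y => bp * dir_derive phi (normal G s) Y)).
        { intros Y [_ HO]; now rewrite Hbeta_p. }
        apply lim_mult; [apply filterlim_const|].
        exact (one_sided_flux G eps Htube RG HRG _ _ phi m cp pp HQp Htp Hp Hpo s Hs).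
      * apply (lim_within_ext _ (fun Y => bm * dir_derive phi (normal G s) Y)).
        { intros Y [_ HO]; now rewrite Hbeta_m. }
        apply lim_mult; [apply filterlim_const|].
        exact (one_sided_flux G eps Htube RG HRG _ _ phi m cm pm HQm Htm Hm' Hmo s Hs).
      * rewrite Hflux by exact Hsab; ring.
Qed.
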